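(* Suppose the star connected occupied component $C(0)$ containing the origin is finite. Then there exists a unique plus connected $S$-cycle $G_{out} = (V_1,\ldots,V_s)$ with the following properties. (i) For every $i$, $1 \le i \le s$, the square $V_i \in \{S_k\}$ is vacant and belongs to $\Lambda_0$. (ii) The outermost boundary of $G_{out}$ is a single cycle $\partial_G$ consisting only of edges of the squares $\{V_i\}_{1 \le i \le s}$. Every vacant square $V_i$, $1 \le i \le s$, is contained in the interior of $\partial_G$. Every edge in the dual skeleton $SK(G_{out})$ is contained in the interior of $\partial_G$. (iii) Every occupied square in the component $C(0)$ is contained in the interior of the dual skeleton $SK(G_{out})$. If a vacant square $Y \in \Lambda_0$ does not belong to $G_{out}$, then $Y$ is contained in the interior of $SK(G_{out})$. (iv) If $F_{out} \neq G_{out}$ is any plus connected $S$-cycle that satisfies (i)-(iii) (with $F_{out}$ in place of $G_{out}$), then $SK(F_{out}) \neq SK(G_{out})$. Moreover, every edge of $SK(F_{out})$ either belongs to $SK(G_{out})$ or is contained in the interior of $SK(G_{out})$.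
   Context: **Squares and states.** $\mathbb{R}^2$ is tiled by the axis-parallel closed unit squares $\{S_k\}_{k\ge 0}$ whose centres are the points of $\mathbb{Z}^2$; $S_0$ is the square centred at the origin. Each $S_k$ is assigned one of two states, occupied or vacant (an arbitrary assignment), and $S_0$ is occupied. For $i \ne j$, the squares $S_i$ and $S_j$ are *star adjacent* if they share a corner and *plus adjacent* if they share an edge (so plus adjacent squares are also star adjacent). **Component.** A star connected $S$-path from $S_i$ to $S_j$ is a sequence of distinct squares $(Y_1,\ldots,Y_t)$ of $\{S_k\}$ with $Y_1=S_i$, $Y_t=S_j$ and $Y_l$ star adjacent to $Y_{l+1}$ for $1\le l\le t-1$; it is occupied if all its squares are occupied. $C(0)$ is the collection of all occupied squares connected to $S_0$ by an occupied star connected $S$-path (including $S_0$). $\Lambda_0$ is the set of all vacant squares in $\{S_k\}$ that are star adjacent to (share a corner with) some occupied square of $C(0)$. **Graphs and cycles.** $G$ is the graph whose vertices are the corners and whose edges are the edges of the squares $\{S_k\}$. The dual graph $G_d$ is $G$ shifted by $(\frac12,\frac12)$; its vertices are the centres of the squares $S_k$, and two of these are joined by a dual edge if and only if they are at distance $1$. A cycle in $G$ or $G_d$ is a simple closed cycle in the graph-theoretic sense (no repeated vertices, at least four edges). As a closed curve it divides the plane into a bounded region, its *interior*, and an unbounded region, its *exterior*. An edge not belonging to a cycle $C$ of the same graph is contained in the interior (exterior) of $C$ if the open segment (the edge without its endvertices) lies in the interior (exterior) of $C$. An edge of $G_d$ is contained in the interior of a cycle of $G$ if all its points lie in the interior.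 A square is contained in the interior of a cycle if its topological interior is a subset of the interior of the cycle. **Outermost boundary.** For a finite collection $\mathcal{C}$ of squares of $\{S_k\}$ forming a connected (star or plus) component, let $G_{\mathcal{C}}$ be the subgraph of $G$ consisting of all corners and edges of the squares in $\mathcal{C}$. An edge $e$ of $G_{\mathcal{C}}$ is an *outermost boundary edge* of $\mathcal{C}$ if for every cycle $C$ in $G_{\mathcal{C}}$, either $e$ is an edge of $C$ or $e$ is contained in the exterior of $C$. The *outermost boundary* of $\mathcal{C}$ is the set of all its outermost boundary edges. The outermost boundary of an $S$-cycle is the outermost boundary of the collection of its squares. **Plus connected $S$-cycles and skeletons.** A sequence $(J_1,\ldots,J_m)$ of distinct squares of $\{S_k\}$ is a *plus connected $S$-path* if $J_i$ is plus adjacent to $J_{i+1}$ for $1\le i\le m-1$. A sequence $L=(J_1,\ldots,J_m)$ of distinct squares with $m\ge 3$ is a *plus connected $S$-cycle* if $(J_1,\ldots,J_{m-1})$ is a plus connected $S$-path and $J_m$ is plus adjacent to both $J_{m-1}$ and $J_1$. Two $S$-cycles that differ only by a cyclic shift and/or a reversal of the order of the sequence are regarded as the same $S$-cycle. If $z_k$ is the centre of $J_k$, the *dual skeleton* $SK(L)$ is the cycle in $G_d$ with edges $z_1z_2, z_2z_3,\ldots,z_{m-1}z_m,z_mz_1$. *)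

(* Defs.v *)
From HB Require Import structures.
From mathcomp Require Import all_boot all_order all_algebra finmap.
From mathcomp Require Import all_classical all_reals all_analysis.

Set Implicit Arguments.
Unset Strict Implicit.
Unset Printing Implicit Defensive.

Import Order.TTheory GRing.Theory Num.Theory numFieldNormedType.Exports.

Local Open Scope fset_scope.
Local Open Scope classical_set_scope.
Local Open Scope ring_scope.

(* A lattice point z : site stands for three things, depending on context:
   the unit square centred at z, the vertex of the dual graph G_d located at z,
   and the vertex of G located at z + (1/2, 1/2). *)
Notation site := (int * int)%type.

(* An undirected edge xy of G or G_d is the unordered pair [fset x; y]. *)
Notation edge := {fset site}.

Definition origin : site := (0, 0).

(* The vertices of G that are the corners of the square centred at z. *)
Definition sw_corner (z : site) : site := (z.1 - 1, z.2 - 1).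
Definition se_corner (z : site) : site := (z.1, z.2 - 1).
Definition nw_corner (z : site) : site := (z.1 - 1, z.2).
Definition ne_corner (z : site) : site := (z.1, z.2).

Definition square_corners (z : site) : seq site :=
  [:: sw_corner z; se_corner z; nw_corner z; ne_corner z].

Definition square_edges (z : site) : seq edge :=
  [:: [fset sw_corner z; se_corner z]; [fset nw_corner z; ne_corner z];
      [fset sw_corner z; nw_corner z]; [fset se_corner z; ne_corner z]].

Definition star_adjacent : rel site := fun i j =>
  (i != j) && has (fun c => c \in square_corners j) (square_corners i).

Definition plus_adjacent : rel site := fun i j =>
  (i != j) && has (fun e => e \in square_edges j) (square_edges i).

(* (i :: p) is a star connected S-path from i to j. *)
Definition star_path (i j : site) (p : seq site) : Prop :=
  [/\ path star_adjacent i p, uniq (i :: p) & last i p = j].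

(* C(0), for the assignment in which z is occupied iff occ z. *)
Definition component0 (occ : pred site) : set site :=
  [set z | exists2 p, star_path origin z p & all occ (origin :: p)].

Definition Lambda0 (occ : pred site) : set site :=
  [set z | ~~ occ z /\ exists2 w, component0 occ w & star_adjacent z w].

(* The edge set of the subgraph of G formed by the squares in C; the edge set
   of G itself is graph_edges setT. *)
Definition graph_edges (C : set site) : set edge :=
  [set e | exists2 z, C z & e \in square_edges z].

Definition cycle_edges (c : seq site) : set edge :=
  [set [fset x; next c x] | x in [set` c]].

Definition is_cycle (E : set edge) (c : seq site) : Prop :=
  [/\ uniq c, (4 <= size c)%N & cycle_edges c `<=` E].

Definition plus_cycle (L : seq site) : Prop :=
  [/\ uniq L, (3 <= size L)%N & cycle plus_adjacent L].

Definition same_cycle (L L' : seq site) : Prop :=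
  exists k, L' = rot k L \/ L' = rot k (rev L).

(* The centres of the squares of L are the entries of L themselves, now read as
   vertices of G_d. *)
Definition skeleton (L : seq site) : set edge := cycle_edges L.

Section Geometry.
Variable R : realType.
Implicit Types (pos : site -> R * R) (E : set edge) (e : edge) (z : site).

Definition dual_pos z : R * R := (z.1%:~R, z.2%:~R).
Definition primal_pos z : R * R := (z.1%:~R + 2^-1, z.2%:~R + 2^-1).

Definition square z : set (R * R) :=
  [set p | `|p.1 - z.1%:~R| <= 2^-1 /\ `|p.2 - z.2%:~R| <= 2^-1].

(* In the rest of the section, pos (primal_pos for G, dual_pos for G_d) places
   the vertices in the plane. *)
Definition closed_segment pos e : set (R * R) :=
  [set p | exists x y t, [/\ e = [fset x; y], 0 <= t <= 1
                           & p = (1 - t) *: pos x + t *: pos y]].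

Definition open_segment pos e : set (R * R) :=
  [set p | exists x y t, [/\ e = [fset x; y], 0 < t < 1
                           & p = (1 - t) *: pos x + t *: pos y]].

Definition curve pos E : set (R * R) := \bigcup_(e in E) closed_segment pos e.

Definition cycle_interior pos E : set (R * R) :=
  [set p | ~ curve pos E p /\
           bounded_set (connected_component (~` curve pos E) p)].

Definition cycle_exterior pos E : set (R * R) :=
  [set p | ~ curve pos E p /\
           ~ bounded_set (connected_component (~` curve pos E) p)].

Definition square_inside pos E z : Prop :=
  (square z)° `<=` cycle_interior pos E.

Definition outermost_boundary (C : set site) : set edge :=
  [set e | graph_edges C e /\
     forall c, is_cycle (graph_edges C) c ->
       cycle_edges c e \/
       open_segment primal_pos e `<=` cycle_exterior primal_pos (cycle_edges c)].

End Geometry.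

Definition property_i (occ : pred site) (L : seq site) : Prop :=
  forall v, v \in L -> ~~ occ v /\ Lambda0 occ v.

Definition property_ii (R : realType) (L : seq site) : Prop :=
  exists d : seq site,
    [/\ is_cycle (graph_edges setT) d,
        outermost_boundary R [set` L] = cycle_edges d,
        cycle_edges d `<=` graph_edges [set` L],
        (forall v, v \in L ->
           square_inside (@primal_pos R) (cycle_edges d) v)
      & (forall e, skeleton L e ->
           closed_segment (@dual_pos R) e
             `<=` cycle_interior (@primal_pos R) (cycle_edges d))].

Definition property_iii (R : realType) (occ : pred site) (L : seq site) : Prop :=
  (forall z, component0 occ z ->
     square_inside (@dual_pos R) (skeleton L) z) /\
  (forall y, Lambda0 occ y -> y \notin L ->
     square_inside (@dual_pos R) (skeleton L) y).

Definition properties_i_iii (R : realType) (occ : pred site) (L : seq site) :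
    Prop :=
  [/\ property_i occ L, property_ii R L & property_iii R occ L].

Definition property_iv (R : realType) (occ : pred site) (L : seq site) : Prop :=
  forall F, plus_cycle F -> properties_i_iii R occ F -> ~ same_cycle L F ->
    skeleton F <> skeleton L /\
    (forall e, skeleton F e ->
       skeleton L e \/
       open_segment (@dual_pos R) e
         `<=` cycle_interior (@dual_pos R) (skeleton L)).

(* Main.v *)
Require Import Defs.
From mathcomp Require Import all_boot all_order all_algebra finmap.
From mathcomp Require Import all_classical all_reals all_analysis.
From mathcomp Require Import zify ring lra.

Set Implicit Arguments.
Unset Strict Implicit.
Unset Printing Implicit Defensive.

Import Order.TTheory GRing.Theory Num.Theory numFieldNormedType.Exports.

Local Open Scope classical_set_scope.
Local Open Scope ring_scope.

(** The theorem is planar topology, and all of it is reduced to parity arguments on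
    the square lattice.

    Label the unit faces of a lattice so that the face f has the sites f, f -
    (1,0), f - (0,1) and f - (1,1) as its corners. For G this makes the face f the
    square centred at f; for the dual graph it is the square centred at f -
    (1/2,1/2). One combinatorial theory thus serves both graphs. A cycle c has a
    parity function [inside c] on faces, obtained by counting crossings of a
    horizontal ray, and the edges across which it changes are exactly the edges of c
    ([separates_inside]). Conversely, the edges across which any function on faces
    changes form a graph of even degrees. A subgraph of a simple cycle with even
    degrees is empty or the whole cycle, so a set of faces that changes only across
    c is trivial, the inside of c or its complement: this is the discrete Jordan
    theorem [jordan]. Off the curve, a component of its complement is determined by
    the faces that it meets, whence [jordan_interior] and [jordan_exterior]:
    topological interior and exterior are read off from [inside c].

    Cycles are produced by hulls. The hull of a bounded set A of faces adds every
    bounded set of faces that can only be left through A. If A is connected, the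
    edges between the hull and its complement form one simple cycle with the hull as
    inside, and every edge of it borders a face of A ([hull_cycle],
    [hull_boundary]).

    In these terms a plus connected cycle satisfies [properties_i_iii] if and only
    if its vertices lie in Lambda0 and it surrounds all faces with a corner in C(0)
    ([surroundingP]); [property_ii] holds for every plus connected cycle, the
    outermost boundary being the boundary of the hull of its squares. The cycle
    G_out is the boundary of the hull of the union of the faces with a corner in
    C(0) and of the insides of all surrounding cycles. Each of its edges is an edge
    of a surrounding cycle or borders a face with a corner in C(0); either way its
    ends are in Lambda0, so G_out is itself a surrounding cycle and it contains all
    others ([outermost_surrounding]). An edge of another surrounding cycle that is
    not on G_out therefore has an inside face, which is [property_iv]. If L is
    another cycle with all the properties, [property_iv] of L forces the inside of
    G_out into the inside of L, so the two insides, hence the two edge sets, hence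
    the two cycles agree ([edges_inside_sub], [inside_on_cycle], [same_skeleton]). *)

(** * Squares, corners and edges *)

Lemma max_succ (a : int) : Num.max a (a + 1) = a + 1. Proof. lia. Qed.

Lemma min_succ (a : int) : Num.min a (a + 1) = a. Proof. lia. Qed.

Lemma fset2_eq (T : choiceType) (a b x y : T) :
  [fset a; b]%fset = [fset x; y]%fset -> (a = x /\ b = y) \/ (a = y /\ b = x).
Proof.
move=> E.
have : a \in [fset x; y]%fset by rewrite -E fset21.
have : b \in [fset x; y]%fset by rewrite -E fset22.
have : x \in [fset a; b]%fset by rewrite E fset21.
have : y \in [fset a; b]%fset by rewrite E fset22.
move=> /fset2P[]-> /fset2P[]-> /fset2P[]? /fset2P[]?; subst; by [left | right].
Qed.

(** The two faces bordering the edge xy: to the left of or below the edge for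
    [lo_side], to its right or above it for [hi_side].  Taking maxima and minima treats
    horizontal and vertical edges alike. *)
Definition lo_side (x y : site) : site := (Num.max x.1 y.1, Num.max x.2 y.2).
Definition hi_side (x y : site) : site :=
  (Num.min x.1 y.1 + 1, Num.min x.2 y.2 + 1).

Lemma lo_sideC x y : lo_side x y = lo_side y x.
Proof. by rewrite /lo_side ![Num.max x.1 _]maxC ![Num.max x.2 _]maxC. Qed.

Lemma hi_sideC x y : hi_side x y = hi_side y x.
Proof. by rewrite /hi_side ![Num.min x.1 _]minC ![Num.min x.2 _]minC. Qed.

Lemma fset2C (T : choiceType) (a b : T) : [fset a; b]%fset = [fset b; a]%fset.
Proof. by rewrite fsetUC. Qed.

Lemma site_eqE (x y : site) : (x == y) = (x.1 == y.1) && (x.2 == y.2).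
Proof. by case: x y => [? ?] [? ?]; rewrite xpair_eqE. Qed.

Lemma siteP (x y : site) : x.1 = y.1 -> x.2 = y.2 -> x = y.
Proof. by case: x y => [? ?] [? ?] /= -> ->. Qed.

Lemma square_edgesP (z : site) (e : edge) :
  e \in square_edges z <->
  exists x y : site, [/\ e = [fset x; y]%fset, `|x.1 - y.1| + `|x.2 - y.2| = 1
                & z = lo_side x y \/ z = hi_side x y].
Proof.
split.
  rewrite !inE => /or4P[] /eqP->; do 2 eexists; (split; first by []);
    rewrite /lo_side /hi_side /=; try (by lia);
    [right|left|right|left]; apply: siteP => /=; lia.
case=> x [y] [-> d1].
wlog xy : x y d1 / (x.1 <= y.1) && (x.2 <= y.2).
  move=> W; have [|] := boolP ((x.1 <= y.1) && (x.2 <= y.2)); first exact: W.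
  move=> ? h; rewrite fset2C; apply: W; [lia|lia|].
  by rewrite lo_sideC hi_sideC.
have E1 : y = (x.1 + 1, x.2) \/ y = (x.1, x.2 + 1).
  have [[h1 h2]|[h1 h2]] : (y.1 = x.1 + 1 /\ y.2 = x.2) \/ (y.1 = x.1 /\ y.2 = x.2 + 1) by lia.
    by left; apply: siteP.
  by right; apply: siteP.
have mem4 (a b c d : edge) (t : edge) : t = a \/ t = b \/ t = c \/ t = d ->
   t \in [:: a; b; c; d].
  by rewrite !inE => -[->|[->|[->|->]]]; rewrite eqxx ?orbT.
move=> h; apply: mem4.
case: E1 => yE; subst y; move: h; rewrite /lo_side /hi_side /=.
- case=> ->; [right; left|left]; congr ([fset _; _]%fset); apply: siteP => /=; lia.
- case=> ->; [right; right; right|right; right; left];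
  congr ([fset _; _]%fset); apply: siteP => /=; lia.
Qed.

Lemma plus_adjacentE (x y : site) :
  plus_adjacent x y = (`|x.1 - y.1| + `|x.2 - y.2| == 1).
Proof.
apply/idP/idP.
  move=> /andP[nxy /hasP[e /square_edgesP[a [b [-> d1 Hx]]]]].
  move=> /square_edgesP[a' [b' [/fset2_eq E d1' Hy]]].
  have {}Hy : y = lo_side a b \/ y = hi_side a b.
    case: E => -[? ?]; subst a' b' => //.
    by rewrite lo_sideC hi_sideC.
  move: nxy; rewrite site_eqE.
  by case: Hx Hy => -> [] ->; rewrite /lo_side /hi_side /=; lia.
move=> d1; apply/andP; split; first by rewrite site_eqE; lia.
apply/hasP; exists [fset (Num.min x.1 y.1, Num.min x.2 y.2);
                    (Num.max x.1 y.1 - 1, Num.max x.2 y.2 - 1)]%fset.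
  apply/square_edgesP; do 2 eexists; split; [by []|rewrite /=; lia|].
  have : x.1 < y.1 \/ x.2 < y.2 \/ x.1 > y.1 \/ x.2 > y.2 by lia.
  by case=> [?|[?|[?|?]]]; [left|left|right|right]; apply: siteP => /=; lia.
apply/square_edgesP; do 2 eexists; split; [by []|rewrite /=; lia|].
have : x.1 < y.1 \/ x.2 < y.2 \/ x.1 > y.1 \/ x.2 > y.2 by lia.
by case=> [?|[?|[?|?]]]; [right|right|left|left]; apply: siteP => /=; lia.
Qed.

Lemma square_cornersE (z c : site) : (c \in square_corners z) =
  ((c.1 == z.1) || (c.1 == z.1 - 1)) && ((c.2 == z.2) || (c.2 == z.2 - 1)).
Proof.
rewrite !inE !site_eqE /=.
by do 2 case: (c.1 == _); do 2 case: (c.2 == _).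
Qed.

Lemma star_adjacentE (x y : site) :
  star_adjacent x y =
  [&& x != y, `|x.1 - y.1| <= 1 & `|x.2 - y.2| <= 1].
Proof.
rewrite /star_adjacent; case: (eqVneq x y) => [//|nxy]; rewrite !andTb.
apply/hasP/andP.
  by case=> c; rewrite !square_cornersE; lia.
move=> d1; exists (Num.min x.1 y.1, Num.min x.2 y.2);
  rewrite square_cornersE /=; lia.
Qed.

Lemma plus_adjacent_sym x y : plus_adjacent x y = plus_adjacent y x.
Proof. by rewrite !plus_adjacentE; lia. Qed.

Lemma plus_adjacent_neq x y : plus_adjacent x y -> x != y.
Proof. by case/andP. Qed.

Lemma graph_edgesP (C : set site) (e : edge) :
  graph_edges C e <->
  exists x y : site, [/\ e = [fset x; y]%fset, plus_adjacent x y
                & C (lo_side x y) \/ C (hi_side x y)].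
Proof.
split.
  case=> z Cz /square_edgesP[x [y [-> d1 h]]]; exists x, y.
  by rewrite plus_adjacentE d1 eqxx; case: h Cz => <-; split; auto.
case=> x [y [-> + h]]; rewrite plus_adjacentE => /eqP d1.
case: h => h; [exists (lo_side x y)|exists (hi_side x y)] => //;
  by apply/square_edgesP; exists x, y; split; auto.
Qed.

(** * Parity around a lattice point *)

Definition separates (D : pred site) x y := D (lo_side x y) (+) D (hi_side x y).

Lemma separatesC D x y : separates D x y = separates D y x.
Proof. by rewrite /separates lo_sideC hi_sideC. Qed.

Lemma separates_around (D : pred site) (v : site) :
  [/\ separates D v (v.1 - 1, v.2) = D v (+) D (v.1, v.2 + 1),
      separates D v (v.1 + 1, v.2) = D (v.1 + 1, v.2) (+) D (v.1 + 1, v.2 + 1),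
      separates D v (v.1, v.2 - 1) = D v (+) D (v.1 + 1, v.2)
    & separates D v (v.1, v.2 + 1) = D (v.1, v.2 + 1) (+) D (v.1 + 1, v.2 + 1)].
Proof. by split; congr (D _ (+) D _); apply: siteP => /=; lia. Qed.

(** Going once around v, a set of faces is entered as often as it is left. *)
Lemma even_degree (D : pred site) (v : site) :
  separates D v (v.1 - 1, v.2) (+) separates D v (v.1 + 1, v.2) (+)
  separates D v (v.1, v.2 - 1) (+) separates D v (v.1, v.2 + 1) = false.
Proof.
have [-> -> -> ->] := separates_around D v.
by do 4 case: (D _).
Qed.

Lemma neighbours (v y : site) : plus_adjacent v y ->
  y \in [:: (v.1 - 1, v.2); (v.1 + 1, v.2); (v.1, v.2 - 1); (v.1, v.2 + 1)].
Proof. by rewrite plus_adjacentE !inE !site_eqE /=; lia. Qed.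

(** Orients every edge to the right or upwards. *)
Lemma plus_adjacent_ind (Q : site -> site -> Prop) :
  (forall x y, Q x y -> Q y x) ->
  (forall a b, Q (a, b) (a + 1, b)) -> (forall a b, Q (a, b) (a, b + 1)) ->
  forall x y, plus_adjacent x y -> Q x y.
Proof.
move=> Qsym Qh Qv x y /neighbours; rewrite !inE; case: x => a b /=.
case/or4P => /eqP->; [apply: Qsym| |apply: Qsym|] => //.
- by have := Qh (a - 1) b; rewrite subrK.
- by have := Qv a (b - 1); rewrite subrK.
Qed.

Lemma one_neighbour (v y : site) : plus_adjacent v y ->
  ((v.1 - 1, v.2) == y) (+) ((v.1 + 1, v.2) == y) (+)
  ((v.1, v.2 - 1) == y) (+) ((v.1, v.2 + 1) == y).
Proof.
move=> /neighbours; rewrite !inE => /or4P[] /eqP->; rewrite !site_eqE /=; lia.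
Qed.

(** The form in which even degrees are used along a cycle: what happens on one edge of
    the cycle at v propagates to the other one. *)
Lemma even_degree2 (D : pred site) (v y z : site) :
  plus_adjacent v y -> plus_adjacent v z -> y != z ->
  (forall w, plus_adjacent v w -> w != y -> w != z -> ~~ separates D v w) ->
  separates D v y = separates D v z.
Proof.
move=> vy vz yz only.
have E w : plus_adjacent v w -> separates D v w =
   ((w == y) && separates D v y) (+) ((w == z) && separates D v z).
  move=> vw; case: (eqVneq w y) yz => [->|wy] yz /=.
    by rewrite (negbTE yz) addbF.
  case: (eqVneq w z) => [->|wz] //=; exact/negbTE/only.
have := even_degree D v.
rewrite (E (v.1 - 1, v.2)) ?(E (v.1 + 1, v.2)) ?(E (v.1, v.2 - 1))
  ?(E (v.1, v.2 + 1)); try (by rewrite plus_adjacentE /=; lia).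
have := one_neighbour vy; have := one_neighbour vz.
by do 8 case: (_ == _) => //=; case: (separates D v y); case: (separates D v z).
Qed.

Lemma even_degree_ex (D : pred site) (v y : site) :
  plus_adjacent v y -> separates D v y ->
  exists z, [/\ plus_adjacent v z, z != y & separates D v z].
Proof.
move=> vy sy; apply: contrapT => N.
have only w : plus_adjacent v w -> w != y -> ~~ separates D v w.
  by move=> vw wy; apply/negP => sw; apply: N; exists w.
have [z [vz zy]] : exists z, plus_adjacent v z /\ z != y.
  case: (eqVneq y (v.1, v.2 + 1)) => [->|ny].
    by exists (v.1 - 1, v.2); rewrite plus_adjacentE site_eqE /=; split; lia.
  by exists (v.1, v.2 + 1); rewrite eq_sym ny plus_adjacentE /=; split; lia.
have := even_degree2 vy vz; rewrite eq_sym => /(_ D zy) E.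
by move: sy; rewrite E ?(negbTE (only z vz zy)) // => w vw wy _; exact: only.
Qed.

(** * Cycles and the parity of crossings *)

Definition on_cycle (c : seq site) x y :=
  (x \in c) && (y == next c x) || (y \in c) && (x == next c y).

Lemma on_cycle_next c x : x \in c -> on_cycle c x (next c x).
Proof. by rewrite /on_cycle => ->; rewrite eqxx. Qed.

Lemma on_cycle_mem c x y : on_cycle c x y -> (x \in c) && (y \in c).
Proof. by case/orP => /andP[h /eqP ->]; rewrite mem_next h. Qed.

Lemma cycle_edgesP c x y : cycle_edges c [fset x; y]%fset <-> on_cycle c x y.
Proof.
split.
  case=> z /= zc /fset2_eq[[<- <-]|[<- <-]]; rewrite /on_cycle zc eqxx //.
  by rewrite orbT.
case/orP => /andP[xc /eqP->]; first by exists x.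
by exists y => //; rewrite fset2C.
Qed.

Lemma plus_cycle_next c x :
  plus_cycle c -> x \in c -> plus_adjacent x (next c x).
Proof. by case=> _ _ Hc xc; apply: next_cycle Hc xc. Qed.

Lemma plus_cycle_mem c : plus_cycle c -> exists x, x \in c.
Proof. by case: c => [[]|a c _] //; exists a; rewrite mem_head. Qed.

Lemma on_cycle_adjacent c x y : plus_cycle c -> on_cycle c x y ->
  plus_adjacent x y.
Proof.
move=> Hc /orP[] /andP[xc /eqP->]; first exact: plus_cycle_next.
by rewrite plus_adjacent_sym; apply: plus_cycle_next.
Qed.

(** A cycle of length at least 3 does not traverse an edge back and forth; otherwise
    that edge would be counted twice and parity would not see it. *)
Lemma next2_neq (T : eqType) (c : seq T) x :
  uniq c -> (3 <= size c)%N -> x \in c -> next c (next c x) != x.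
Proof.
move=> Uc Sc /rot_to[i p E]; rewrite -!(next_rot i Uc) E.
move: Uc Sc; rewrite -(rot_uniq i) -(size_rot i) E.
case: p {E} => [|y [|z p]] //= /andP[]; rewrite !inE !negb_or eqxx.
move=> /and3P[xy xz _] _ _.
by rewrite (eq_sym y) (negbTE xy) eqxx eq_sym.
Qed.

(** A closed walk changes sides of P an even number of times. *)
Lemma xor_next (T : eqType) (c : seq T) (P : pred T) : uniq c ->
  \big[addb/false]_(x <- c) (P x (+) P (next c x)) = false.
Proof.
move=> Uc; rewrite big_split /=.
have -> : \big[addb/false]_(x <- c) P (next c x) = \big[addb/false]_(x <- c) P x.
  rewrite -(big_map (next c) xpredT P); apply: perm_big; apply: uniq_perm => //.
    by rewrite map_inj_uniq //; apply: can_inj (prev_next Uc).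
  move=> x; apply/mapP/idP => [[y yc ->]|xc]; first by rewrite mem_next.
  by exists (prev c x); rewrite ?mem_prev ?next_prev.
exact: addbb.
Qed.

Lemma xor_mem (T : eqType) (c : seq T) (u : T) (Q : pred T) : uniq c ->
  \big[addb/false]_(x <- c) ((x == u) && Q x) = (u \in c) && Q u.
Proof.
elim: c => [|a c IH] /=; first by rewrite big_nil.
case/andP=> ac Uc; rewrite big_cons IH // inE eq_sym.
by case: eqVneq ac => //= -> /negbTE ->; rewrite addbF.
Qed.

(** The edge xy meets the horizontal ray that starts at the centre of the face f and
    runs to the right. *)
Definition crosses (f x y : site) :=
  [&& x.1 == y.1, f.1 <= x.1 & Num.max x.2 y.2 == f.2].

Definition inside (c : seq site) (f : site) : bool :=
  \big[addb/false]_(x <- c) crosses f x (next c x).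

(** The rays of the two faces bordering uv can only disagree about xy because xy is
    uv itself or, when uv is horizontal, because xy enters or leaves the half line P to
    the right of uv, which lies between the two rays.  The second contribution is of
    the kind summed up by [xor_next]. *)
Lemma crosses_sides u v x y : plus_adjacent u v -> plus_adjacent x y ->
  let P (z : site) := [&& u.2 == v.2, z.2 == u.2 & Num.max u.1 v.1 <= z.1] in
  crosses (lo_side u v) x y (+) crosses (hi_side u v) x y =
  (P x (+) P y) (+)
    (((x == u) && (y == v)) (+) ((x == v) && (y == u))).
Proof.
move=> uv; move: u v uv x y.
have crossesC f x y : crosses f x y = crosses f y x.
  by rewrite /crosses maxC eq_sym; case: eqP => // ->.
have nS (a : int) : (a == a + 1) = false by lia.
have nS' (a : int) : (a + 1 == a) = false by lia.
have eSS (a b : int) : (a + 1 == b + 1) = (a == b) by lia.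
have swap (p q r s A B : bool) : (A (+) B) (+) ((p && q) (+) (r && s)) =
  (B (+) A) (+) ((s && r) (+) (q && p)).
  by case: p q r s A B => [] [] [] [] [] [].
apply: plus_adjacent_ind => [u v H x y xy /=|a b|a b].
- rewrite lo_sideC hi_sideC H // (maxC u.1) (eq_sym u.2).
  by case: eqVneq => [->|_] /=; [congr (_ (+) _)|]; exact: addbC.
- apply: plus_adjacent_ind => [x y|x1 x2|x1 x2] /=.
  + rewrite !(crossesC _ y) => ->.
    exact: swap.
  + rewrite /crosses /= ?nS !site_eqE /= max_succ eqxx /=.
    case: (eqVneq x2 b) => [_|_]; rewrite ?andbF ?andbT /= ?eSS //; lia.
  + rewrite /crosses /= eqxx !site_eqE /= !max_succ !maxxx !minxx !min_succ /= ?eSS.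
    rewrite ?nS ?nS'; case: (eqVneq x2 b) => [->|_]; rewrite ?andbF ?andbT /= ?eqxx; lia.
- apply: plus_adjacent_ind => [x y|x1 x2|x1 x2] /=.
  + rewrite !(crossesC _ y) => ->.
    exact: swap.
  + rewrite /crosses /= ?nS !site_eqE /=.
    case: (eqVneq x2 b) => [->|_]; rewrite ?nS ?andbF //=; lia.
  + rewrite /crosses /= eqxx !site_eqE /= !max_succ !maxxx !minxx !min_succ /= ?eSS ?nS.
    case: (eqVneq x2 b) => [->|_]; rewrite ?andbF ?nS ?andbT //=; lia.
Qed.

(** After summation over the cycle only the contributions of uv itself are left, and
    uv is traversed at most once. *)
Lemma separates_inside c u v : plus_cycle c -> plus_adjacent u v ->
  separates (inside c) u v = on_cycle c u v.
Proof.
move=> Hc uv; have [Uc Sc _] := Hc.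
pose P (z : site) := [&& u.2 == v.2, z.2 == u.2 & Num.max u.1 v.1 <= z.1].
rewrite /separates /inside -big_split /=.
rewrite (eq_big_seq (fun x => (P x (+) P (next c x)) (+)
   (((x == u) && (next c x == v)) (+) ((x == v) && (next c x == u))))); last first.
  by move=> x xc; rewrite crosses_sides //; apply: plus_cycle_next.
rewrite !big_split /= -big_split xor_next // (xor_mem _ (fun x => next c x == v)) //.
rewrite (xor_mem _ (fun x => next c x == u)) // /on_cycle.
rewrite addFb ![next c _ == _]eq_sym.
have [uc|] := boolP (u \in c); last by [].
have [->|//] := eqVneq v (next c u).
by rewrite mem_next uc (eq_sym u) (negbTE (next2_neq Uc Sc uc)).
Qed.

Definition bounded_region (D : pred site) :=
  exists N : int, forall f, D f -> `|f.1| <= N /\ `|f.2| <= N.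

Lemma bounded_region_seq (s : seq site) : bounded_region (mem s).
Proof.
elim: s => [|a s [N HN]]; first by exists 0.
exists (Num.max N (Num.max `|a.1| `|a.2|)) => f /=; rewrite inE.
by case/orP => [/eqP->|/HN]; lia.
Qed.

(** A ray starting to the left of the cycle crosses it as often as the whole horizontal
    line does, which is evenly often since a cycle returns to the half plane it left. *)
Lemma inside_bound c (N : int) f : plus_cycle c ->
  (forall x : site, x \in c -> `|x.1| <= N /\ `|x.2| <= N) ->
  inside c f -> `|f.1| <= N + 1 /\ `|f.2| <= N + 1.
Proof.
move=> Hc HN; have [Uc _ _] := Hc; apply: contraPP.
move=> /not_andP => Hf0.
have Hf : (N + 1 < `|f.1|) || (N + 1 < `|f.2|).
  by apply/orP; case: Hf0 => /negP; rewrite -ltNge; auto.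
move=> {Hf0}.
have adj (x y : site) : x \in c -> y = next c x ->
    [/\ `|x.1| <= N, `|x.2| <= N, `|y.1| <= N, `|y.2| <= N &
      `|x.1 - y.1| + `|x.2 - y.2| == 1].
  move=> xc ->; have [? ?] := HN x xc.
  have [|? ?] := HN (next c x); first by rewrite /= mem_next.
  by rewrite -plus_adjacentE plus_cycle_next.
have [f1|f1] := leP f.1 (- N); apply/negP; rewrite /inside.
  have E (x y : site) : x \in c -> y = next c x ->
      crosses f x y = (f.2 <= x.2) (+) (f.2 <= y.2).
    by move=> xc /(adj _ _ xc)[]; rewrite /crosses; lia.
  rewrite (eq_big_seq _ (fun x xc => E x _ xc erefl)).
  by rewrite (xor_next (fun x : site => f.2 <= x.2)).
have E (x y : site) : x \in c -> y = next c x -> crosses f x y = false.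
  by move=> xc /(adj _ _ xc)[]; rewrite /crosses; lia.
by rewrite big1_seq // => x /andP[_ xc]; apply: E.
Qed.

Lemma inside_bounded c : plus_cycle c -> bounded_region (inside c).
Proof.
move=> Hc; have [N HN] := bounded_region_seq c.
by exists (N + 1) => f; apply: inside_bound.
Qed.

(** * Connected regions and the discrete Jordan theorem *)

Definition locally_constant (A D : pred site) :=
  forall f g, plus_adjacent f g -> A f -> A g -> D f = D g.

(** Connectedness through constancy of functions: paths of faces never have to be
    constructed or cut. *)
Definition connected_region (A : pred site) :=
  forall D, locally_constant A D -> forall f g, A f -> A g -> D f = D g.

Lemma sides_adjacent x y : plus_adjacent x y ->
  plus_adjacent (lo_side x y) (hi_side x y).
Proof. by rewrite !plus_adjacentE /=; lia. Qed.

Lemma adjacent_sides f g : plus_adjacent f g -> exists x y,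
  plus_adjacent x y /\
  ((lo_side x y = f /\ hi_side x y = g) \/ (lo_side x y = g /\ hi_side x y = f)).
Proof.
move: f g; apply: plus_adjacent_ind.
- by move=> f g [x [y [xy h]]]; exists x, y; split => //; case: h; auto.
- move=> a b; exists (a, b - 1), (a, b); rewrite plus_adjacentE /=; split; first lia.
  by left; split; apply: siteP => /=; lia.
- move=> a b; exists (a - 1, b), (a, b); rewrite plus_adjacentE /=; split; first lia.
  by left; split; apply: siteP => /=; lia.
Qed.

Lemma locally_constant_separates (A D : pred site) :
  (forall x y, plus_adjacent x y -> A (lo_side x y) -> A (hi_side x y) ->
     ~~ separates D x y) -> locally_constant A D.
Proof.
move=> h f g /adjacent_sides[x [y [xy]]].
case=> -[<- <-] A1 A2; [have := h x y xy A1 A2|have := h x y xy A2 A1];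
  by rewrite /separates; do 2 case: (D _).
Qed.

Lemma separates_locally_constant (A D : pred site) x y : locally_constant A D ->
  plus_adjacent x y -> A (lo_side x y) -> A (hi_side x y) ->
  separates D x y = false.
Proof.
by move=> h xy A1 A2; rewrite /separates (h _ (hi_side x y)) ?addbb ?sides_adjacent.
Qed.

Lemma int_const (P : pred int) : (forall a, P a = P (a + 1)) ->
  forall a b, P a = P b.
Proof.
move=> PS; suff E a : P a = P 0 by move=> a b; rewrite !E.
elim/int_ind: a => // n <-.
  by rewrite [RHS]PS; congr P; lia.
by rewrite [LHS]PS; congr P; lia.
Qed.

Lemma locally_constant_predT D : locally_constant predT D ->
  forall f g, D f = D g.
Proof.
move=> h [a b] [a' b'].
rewrite (int_const (P := fun a => D (a, b)) _ a a').
  rewrite (int_const (P := fun b => D (a', b)) _ b b') // => k.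
  by apply: h; rewrite ?plus_adjacentE //=; lia.
by move=> k; apply: h; rewrite ?plus_adjacentE //=; lia.
Qed.

Lemma bounded_region_out D : bounded_region D -> exists f, ~~ D f.
Proof.
case=> N HN; exists (`|N| + 1, 0); apply/negP => /HN /=; lia.
Qed.

Lemma bounded_locally_constant D : bounded_region D -> locally_constant predT D ->
  forall f, D f = false.
Proof.
move=> /bounded_region_out[g Dg] /locally_constant_predT h f.
by rewrite (h f g); apply: negbTE.
Qed.

Lemma bounded_region_sub (D D' : pred site) : (forall f, D f -> D' f) ->
  bounded_region D' -> bounded_region D.
Proof. by move=> s [N HN]; exists N => f /s /HN. Qed.

Lemma next_reach (T : eqType) (c : seq T) x y :
  uniq c -> x \in c -> y \in c -> exists k, y = iter k (next c) x.
Proof.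
move=> Uc xc yc; have [i p E] := rot_to xc.
have /= : fcycle (next c) (x :: p) by rewrite -E rot_cycle; exact: cycle_next.
case/fpathP => n En.
have : y \in rcons p x by rewrite mem_rcons -E mem_rot.
by rewrite En => /trajectP[k _ ->]; exists k.+1; rewrite iterSr.
Qed.

Lemma iter_next_mem (T : eqType) (c : seq T) x k :
  x \in c -> iter k (next c) x \in c.
Proof. by move=> xc; elim: k => //= k; rewrite mem_next. Qed.

Lemma next_const (T : eqType) (c : seq T) (P : pred T) : uniq c ->
  (forall x, x \in c -> P x = P (next c x)) ->
  forall x y, x \in c -> y \in c -> P x = P y.
Proof.
move=> Uc PS x y xc yc; have [k ->] := next_reach Uc xc yc.
by elim: k => //= k ->; apply: PS; exact: iter_next_mem.
Qed.

(** The edges across which D changes have even degree at every vertex and all lie on c,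
    so they are all of c or none of c.  In the first case D and [inside c] change across
    the same edges, and their difference is constant. *)
Lemma jordan c D : plus_cycle c ->
  (forall x y, plus_adjacent x y -> ~~ on_cycle c x y -> ~~ separates D x y) ->
  (forall f g, D f = D g) \/ (exists b, forall f, D f = b (+) inside c f).
Proof.
move=> Hc hD; have [Uc Sc _] := Hc.
have step x : x \in c ->
    separates D x (next c x) = separates D (next c x) (next c (next c x)).
  move=> xc; rewrite separatesC; apply: even_degree2.
  - by rewrite plus_adjacent_sym; apply: plus_cycle_next.
  - by apply: plus_cycle_next => //; rewrite mem_next.
  - by rewrite eq_sym; apply: next2_neq.
  move=> w vw wx wn; apply: hD => //; apply: contra wx.
  case/orP => /andP[wc]; first by rewrite (negbTE wn).
  by move/eqP/(can_inj (prev_next Uc)) ->.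
have [x0 x0c] := plus_cycle_mem Hc.
pose b0 := separates D x0 (next c x0).
have Db x y : plus_adjacent x y -> separates D x y = b0 && on_cycle c x y.
  move=> xy; have [oc|noc] := boolP (on_cycle c x y); last first.
    by rewrite andbF; apply/negbTE/hD.
  have E := next_const Uc step x0c; rewrite andbT.
  by case/orP: oc => /andP[ac /eqP->]; [|rewrite separatesC]; rewrite -(E _ ac).
(* b0 tells whether D changes across the edges of c *)
move: Db; case: b0 => Db.
  right.
  have E : forall f g, D f (+) inside c f = D g (+) inside c g.
    apply: (locally_constant_predT (D := fun f => D f (+) inside c f)).
    apply: locally_constant_separates => x y xy _ _.
    have := Db _ _ xy; rewrite -separates_inside // /separates.
    by do 4 case: (_ (_ x y)).
  exists (D x0 (+) inside c x0) => f.
  by rewrite (E x0 f) -addbA addbb addbF.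
left; apply: locally_constant_predT; apply: locally_constant_separates => x y xy _ _.
by rewrite Db.
Qed.

(** A part of the inside that is closed under adjacency changes only across c, so
    [jordan] leaves only the empty part and the whole inside. *)
Lemma inside_connected c : plus_cycle c -> connected_region (inside c).
Proof.
move=> Hc D lD; pose K f := inside c f && D f.
have [|E|[b E]] := jordan (D := K) Hc.
- move=> x y xy; rewrite -separates_inside // /separates /K.
  have := lD _ _ (sides_adjacent xy).
  case: (inside c _) => //=; case: (inside c _) => //= -> //.
  by rewrite addbb.
- have [g ng] := bounded_region_out (inside_bounded Hc).
  have K0 f : K f = false by rewrite (E f g) /K (negbTE ng).
  by move=> f g' insf insg; have := K0 f; have := K0 g'; rewrite /K insf insg /= => -> ->.
have [g ng] := bounded_region_out (inside_bounded Hc).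
have := E g; rewrite {1}/K (negbTE ng) addbF => b0; move: E; rewrite -b0 => E f g' insf insg.
by have := E f; have := E g'; rewrite /K insf insg /= => -> ->.
Qed.

Definition box (N : int) : seq site :=
  let s := [seq k%:Z - `|N| | k <- iota 0 (2 * absz N).+1] in
  [seq (a, b) | a <- s, b <- s].

Lemma mem_box (N : int) (f : site) : `|f.1| <= N -> `|f.2| <= N -> f \in box N.
Proof.
have M (a : int) : `|a| <= N -> a \in [seq k%:Z - `|N| | k <- iota 0 (2 * absz N).+1].
  move=> h; apply/mapP; exists (absz (a + `|N|)); last by lia.
  by rewrite mem_iota; lia.
case: f => a b /= ha hb; apply/allpairsP; exists (a, b); split => //=; exact: M.
Qed.

(** A boundary vertex has at least two boundary edges.  So the first vertex of a longest
    simple path of boundary edges has a boundary edge besides that of the path; it leads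
    back to the path and closes a cycle. *)
Lemma region_cycle D f0 : bounded_region D -> D f0 ->
  exists c, plus_cycle c /\ forall x, x \in c -> separates D x (next c x).
Proof.
move=> fD Df0; pose e : rel site := fun x y => plus_adjacent x y && separates D x y.
have eC x y : e x y = e y x by rewrite /e plus_adjacent_sym separatesC.
pose P n := `[< exists x p, [/\ size p = n, uniq (x :: p) & path e x p] >].
have [N HN] := fD.
have inbox x y : e x y -> x \in box (N + 1).
  case/andP; rewrite plus_adjacentE => xy.
  move=> sxy; have : D (lo_side x y) || D (hi_side x y).
    by move: sxy; rewrite /separates; do 2 case: (D _).
  by case/orP => /HN /= [? ?]; apply: mem_box; lia.
have exP : exists n, P n.+1.
  apply: contrapT => nP.
  suff /(bounded_locally_constant fD)/(_ f0) : locally_constant predT D by rewrite Df0.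
  apply: locally_constant_separates => x y xy _ _; apply/negP => sxy.
  apply: nP; exists 0%N; apply/asboolP; exists x, [:: y].
  split=> //=; last by rewrite /e xy sxy.
  by rewrite inE andbT (plus_adjacent_neq xy).
have bP n : P n.+1 -> (n <= size (box (N + 1)))%N.
  case/asboolP => x [p [sp Up pp]]; apply: ltnW; rewrite -sp.
  case: p sp Up pp => // y p sp Up pp.
  apply: (leq_trans (leqnSn _)); apply: (uniq_leq_size Up).
  move=> z; rewrite inE => /orP[/eqP->|]; first by case/andP: pp => /inbox.
  move: (y :: p) x pp {sp Up} => q; elim: q => //= a q IH x /andP[exa qa].
  rewrite inE => /orP[/eqP->|/(IH _ qa) //]; by move: exa; rewrite eC => /inbox.
case: (ex_maxnP exP bP) => n /asboolP[x [[|y p] [sp Up pp]]] // maxn.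
have /andP[exy pp'] := pp; case/andP: (exy) => xy sxy.
have [z [xz zy sxz]] := even_degree_ex xy sxy.
have zp : z \in p.
  apply: contrapT => /negP zp.
  suff /maxn : P n.+2 by rewrite ltnn.
  apply/asboolP; exists z, [:: x, y & p]; split.
  - by rewrite /= -sp.
  - rewrite cons_uniq Up andbT !inE !negb_or zy zp andbT.
    by rewrite eq_sym (plus_adjacent_neq xz).
  - by apply/andP; split=> //; rewrite eC /e xz.
case/path.splitP: zp sp Up pp => p1 p2 _ Up pp.
exists [:: x, y & rcons p1 z].
have Uc : uniq [:: x, y & rcons p1 z].
  move: Up; rewrite -!cat_cons cat_uniq => /andP[] //.
have Cc : cycle e [:: x, y & rcons p1 z].
  rewrite /cycle rcons_path; apply/andP; split.
    by move: pp; rewrite -cat_cons cat_path => /andP[].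
  by rewrite /= last_rcons eC /e xz.
split.
  split=> //; first by rewrite /= size_rcons.
  by apply: sub_cycle Cc => a b /andP[].
by move=> a ac; have /andP[] := next_cycle Cc ac.
Qed.

(** * Hulls *)

(** A bounded set D that is locally constant off A is a union of bounded components of
    the complement of A, up to faces of A.  Hence this is A with its holes filled. *)
Definition hull (A : pred site) : pred site := fun f =>
  `[< exists D : pred site,
        [/\ bounded_region D, locally_constant (predC A) D & D f] >].

Lemma hull_max (A D : pred site) f :
  bounded_region D -> locally_constant (predC A) D -> D f -> hull A f.
Proof. by move=> fD lD Df; apply/asboolP; exists D. Qed.

Lemma sub_hull (A : pred site) f : bounded_region A -> A f -> hull A f.
Proof.
move=> fA; apply: hull_max => // g h _ /=.
by move=> /negbTE -> /negbTE ->.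
Qed.

Lemma hull_locally_constant A : locally_constant (predC A) (hull A).
Proof.
suff W f g : plus_adjacent f g -> ~~ A f -> ~~ A g -> hull A f -> hull A g.
  move=> f g fg Af Ag; apply/idP/idP; first exact: W.
  by apply: W => //; rewrite plus_adjacent_sym.
move=> fg Af Ag /asboolP[D [fD lD Df]]; apply: (hull_max fD lD).
by rewrite -(lD f g).
Qed.

(** Outside A the hull is locally constant, so it can be left only from a face of A. *)
Lemma hull_boundary (A : pred site) f g : bounded_region A ->
  plus_adjacent f g -> hull A f -> ~~ hull A g -> A f.
Proof.
move=> fA fg Hf Hg; apply: contraLR Hf => Af.
rewrite (hull_locally_constant fg) //=.
by apply: contra Hg; exact: sub_hull.
Qed.

(** Beyond the bounding box of A one can walk away from f to infinity without meeting A,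
    so no bounded set that is locally constant off A contains f. *)
Lemma hull_bounded A : bounded_region A -> bounded_region (hull A).
Proof.
move=> [N HN]; exists (`|N|) => f /asboolP[D [[M HM] lD Df]].
have out (g : site) : (`|N| < `|g.1|) || (`|N| < `|g.2|) -> ~~ A g.
  by move=> h; apply/negP => /HN; lia.
suff : ~~ ((`|N| < `|f.1|) || (`|N| < `|f.2|)) by rewrite negb_or -!leNgt => /andP[].
apply/negP => fN.
(* s is a direction in which f moves away from the bounding box *)
have [s [s1 fs]] : exists s : site, `|s.1| + `|s.2| = 1 /\
    forall k : nat, (`|N| < `|f.1 + s.1 * k%:Z|) || (`|N| < `|f.2 + s.2 * k%:Z|).
  case/orP: fN => h.
    have [f1|f1] := leP 0 f.1; [exists (1, 0)|exists (-1, 0)]; split => //= k;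
      apply/orP; left; lia.
  have [f1|f1] := leP 0 f.2; [exists (0, 1)|exists (0, -1)]; split => //= k;
    apply/orP; right; lia.
have Dk (k : nat) : D (f.1 + s.1 * k%:Z, f.2 + s.2 * k%:Z).
  elim: k => [|k IH]; first by rewrite !mulr0 !addr0; case: (f) Df.
  rewrite -(lD (f.1 + s.1 * k%:Z, f.2 + s.2 * k%:Z)); first exact: IH.
  - by rewrite plus_adjacentE /=; move: s1; lia.
  - by rewrite /=; apply: out; apply: (fs k).
  - by rewrite /=; apply: out; apply: (fs k.+1).
have := HM _ (Dk (absz M + absz f.1 + absz f.2 + 1)%N) => /=.
have : s.1 = 1 \/ s.1 = -1 \/ s.2 = 1 \/ s.2 = -1 by lia.
by move=> [->|[->|[->|->]]]; lia.
Qed.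

(** A part of the hull without faces of A has no boundary at all. *)
Lemma hull_connected A f0 : bounded_region A -> A f0 -> connected_region A ->
  connected_region (hull A).
Proof.
move=> fA Af0 cA D lD; pose K f := hull A f && (D f (+) D f0).
suff K0 f : K f = false.
  by move=> f g Hf Hg; have := K0 f; have := K0 g; rewrite /K Hf Hg /=; do 3 case: (D _).
apply: bounded_locally_constant.
  by apply: bounded_region_sub (hull_bounded fA) => g /andP[].
have DA f' : A f' -> D f' = D f0.
  move=> Af'; apply: cA => // g h gh Ag Ah; apply: lD => //; exact: sub_hull.
have B f' g : plus_adjacent f' g -> hull A f' -> ~~ hull A g -> D f' = D f0.
  by move=> fg Hf Hg; apply: DA; apply: hull_boundary fA fg Hf Hg.
move=> f' g fg _ _; rewrite /K.
have [Hf|Hf] := boolP (hull A f'); have [Hg|Hg] := boolP (hull A g) => //=.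
- by rewrite (lD f' g).
- by rewrite (B f' g) // addbb.
- by rewrite (B g f') ?addbb // plus_adjacent_sym.
Qed.

(** Take any cycle c of boundary edges of the hull.  Its inside is locally constant off
    A, hence contained in the hull; the hull is connected and does not cross c, hence
    contained in the inside.  So c uses all the boundary edges, and no pinching
    of the boundary has to be excluded by hand. *)
Lemma hull_cycle A f0 : bounded_region A -> A f0 -> connected_region A ->
  exists c, plus_cycle c /\ inside c =1 hull A.
Proof.
move=> fA Af0 cA.
have fH := hull_bounded fA; have Hf0 := sub_hull fA Af0.
have [c [Hc sc]] := region_cycle fH Hf0.
have {}sc x y : on_cycle c x y -> separates (hull A) x y.
  by case/orP => /andP[/sc + /eqP->]; rewrite // separatesC.
exists c; split => //.
have cH f : inside c f -> hull A f.
  apply: hull_max; first exact: inside_bounded.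
  apply: locally_constant_separates => x y xy A1 A2.
  rewrite separates_inside //; apply/negP => /sc.
  by rewrite (separates_locally_constant (@hull_locally_constant A)).
have lcH : locally_constant (hull A) (inside c).
  apply: locally_constant_separates => x y xy A1 A2.
  by rewrite separates_inside //; apply/negP => /sc; rewrite /separates A1 A2.
have [g cg] : exists g, inside c g.
  have [x xc] := plus_cycle_mem Hc.
  have := separates_inside Hc (plus_cycle_next Hc xc); rewrite on_cycle_next //.
  rewrite /separates; case E : (inside c _) => /=; first by eexists; apply: E.
  by move=> ?; eexists; eassumption.
move=> f; apply/idP/idP; first exact: cH.
move=> Hf; by rewrite (hull_connected fA Af0 cA lcH Hf (cH g cg)).
Qed.

(** * The lattice drawn in the plane *)

Lemma intr_ltD1 (R : realType) (a b : int) :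
  (a%:~R : R) < b%:~R + 1 -> a <= b.
Proof. by move=> h; rewrite -ltzD1 -(ltr_int R) rmorphD. Qed.

Section Plane.
Variables (R : realType) (s : R).
Implicit Types (p q : R * R) (x y f g : site) (c : seq site).

(** The shift s is 0 for the dual graph and 1/2 for G. *)
Definition shifted_pos (z : site) : R * R := (z.1%:~R + s, z.2%:~R + s).

Definition face_centre (f : site) : R * R :=
  (f.1%:~R + s - 2^-1, f.2%:~R + s - 2^-1).

Definition face (f : site) : set (R * R) :=
  [set p | f.1%:~R - 1 <= p.1 - s <= f.1%:~R /\
           f.2%:~R - 1 <= p.2 - s <= f.2%:~R].

Let pos := shifted_pos.

(** Open (o = true) and closed horizontal edges at once. *)
Lemma segment_hE (o : bool) (a b : int) p :
  (exists x y t, [/\ [fset (a, b); ((a + 1)%R, b)]%fset = [fset x; y]%fset :> edge,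
     (if o then 0 < t < 1 else 0 <= t <= 1)
     & p = (1 - t) *: pos x + t *: pos y]) <->
  (if o then a%:~R < p.1 - s < a%:~R + 1 else a%:~R <= p.1 - s <= a%:~R + 1) /\
  p.2 - s = b%:~R.
Proof.
case: p => p1 p2; split.
  case=> x [y] [t] [/fset2_eq E t01 [-> ->]] /=.
  by case: E => -[<- <-] /=; rewrite !rmorphD /= /GRing.scale /=; split; case: o t01; lra.
move=> /= [h1 h2].
exists (a, b), (a + 1, b), (p1 - s - a%:~R); split => //.
  by case: o h1; lra.
by congr pair; rewrite /= ?rmorphD /= /GRing.scale /=; lra.
Qed.

Lemma segment_vE (o : bool) (a b : int) p :
  (exists x y t, [/\ [fset (a, b); (a, (b + 1)%R)]%fset = [fset x; y]%fset :> edge,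
     (if o then 0 < t < 1 else 0 <= t <= 1)
     & p = (1 - t) *: pos x + t *: pos y]) <->
  (if o then b%:~R < p.2 - s < b%:~R + 1 else b%:~R <= p.2 - s <= b%:~R + 1) /\
  p.1 - s = a%:~R.
Proof.
case: p => p1 p2; split.
  case=> x [y] [t] [/fset2_eq E t01 [-> ->]] /=.
  by case: E => -[<- <-] /=; rewrite !rmorphD /= /GRing.scale /=; split; case: o t01; lra.
move=> /= [h1 h2].
exists (a, b), (a, b + 1), (p2 - s - b%:~R); split => //.
  by case: o h1; lra.
by congr pair; rewrite /= ?rmorphD /= /GRing.scale /=; lra.
Qed.

Definition edge_box x y : set (R * R) :=
  [set p | (Num.min x.1 y.1)%:~R <= p.1 - s <= (Num.max x.1 y.1)%:~R /\
           (Num.min x.2 y.2)%:~R <= p.2 - s <= (Num.max x.2 y.2)%:~R].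

Lemma closed_segmentE x y p : plus_adjacent x y ->
  closed_segment pos [fset x; y]%fset p <-> edge_box x y p.
Proof.
move=> xy; move: x y xy p; apply: plus_adjacent_ind.
- by move=> x y H p; rewrite fset2C H /edge_box /= ![Num.min y.1 _]minC
    ![Num.min y.2 _]minC ![Num.max y.1 _]maxC ![Num.max y.2 _]maxC.
- move=> a b p; rewrite [X in X <-> _](segment_hE false).
  have -> : edge_box (a, b) (a + 1, b) p <->
    a%:~R <= p.1 - s <= a%:~R + 1 /\ b%:~R <= p.2 - s <= b%:~R.
    rewrite /edge_box /= minxx maxxx.
  rewrite min_succ max_succ.
    by rewrite rmorphD.
  by split=> -[-> h]; split=> //; lra.
- move=> a b p; rewrite [X in X <-> _](segment_vE false).
  have -> : edge_box (a, b) (a, b + 1) p <->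
    a%:~R <= p.1 - s <= a%:~R /\ b%:~R <= p.2 - s <= b%:~R + 1.
    rewrite /edge_box /= minxx maxxx.
  rewrite min_succ max_succ.
    by rewrite rmorphD.
  by split=> -[h1 h2]; split=> //; lra.
Qed.

Lemma open_closed_segment (e : edge) : open_segment pos e `<=` closed_segment pos e.
Proof.
move=> p [x [y [t [-> t01 ->]]]]; exists x, y, t; split=> //.
by case/andP: t01 => /ltW -> /ltW ->.
Qed.

(** Two distinct drawn edges meet at most in an endpoint, so a point of an open edge
    determines the edge. *)
Lemma open_segment_edge x y x' y' p : plus_adjacent x y -> plus_adjacent x' y' ->
  open_segment pos [fset x; y]%fset p -> closed_segment pos [fset x'; y']%fset p ->
  [fset x; y]%fset = [fset x'; y']%fset :> edge.
Proof.
move=> xy x'y'; move: x y xy x' y' x'y' p; apply: plus_adjacent_ind.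
- by move=> x y H x' y' x'y' p; rewrite fset2C; apply: H.
- move=> a b; apply: plus_adjacent_ind.
  + by move=> x y H p; rewrite [[fset y; x]%fset]fset2C; apply: H.
  + move=> a' b' p /(segment_hE true) /= [h1 h2] /(segment_hE false) /= [h3 h4].
    have -> : a = a' by apply/le_anti/andP; split; apply: (@intr_ltD1 R); lra.
    by have -> : b = b' by apply/le_anti/andP; split; apply: (@intr_ltD1 R); lra.
  + move=> a' b' p /(segment_hE true) /= [h1 h2] /(segment_vE false) /= [h3 h4].
    have : a' <= a by apply: (@intr_ltD1 R); lra.
    have : a + 1 <= a' by apply: (@intr_ltD1 R); rewrite rmorphD /=; lra.
    lia.
- move=> a b; apply: plus_adjacent_ind.
  + by move=> x y H p; rewrite [[fset y; x]%fset]fset2C; apply: H.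
  + move=> a' b' p /(segment_vE true) /= [h1 h2] /(segment_hE false) /= [h3 h4].
    have : b' <= b by apply: (@intr_ltD1 R); lra.
    have : b + 1 <= b' by apply: (@intr_ltD1 R); rewrite rmorphD /=; lra.
    lia.
  + move=> a' b' p /(segment_vE true) /= [h1 h2] /(segment_vE false) /= [h3 h4].
    have -> : a = a' by apply/le_anti/andP; split; apply: (@intr_ltD1 R); lra.
    by have -> : b = b' by apply/le_anti/andP; split; apply: (@intr_ltD1 R); lra.
Qed.

Lemma open_segment_nonempty x y : exists p, open_segment pos [fset x; y]%fset p.
Proof. by eexists; exists x, y, 2^-1; split => //; lra. Qed.

Lemma sides_segment x y p : plus_adjacent x y ->
  closed_segment pos [fset x; y]%fset p <-> face (lo_side x y) p /\ face (hi_side x y) p.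
Proof.
move=> xy; rewrite closed_segmentE //; move: x y xy p; apply: plus_adjacent_ind.
- by move=> x y H p; rewrite lo_sideC hi_sideC -H /edge_box /= ![Num.min y.1 _]minC
    ![Num.min y.2 _]minC ![Num.max y.1 _]maxC ![Num.max y.2 _]maxC.
- move=> a b p; rewrite /edge_box /face /lo_side /hi_side /= minxx maxxx.
  rewrite min_succ max_succ.
  rewrite !rmorphD /=; split; last by case=> -[? ?] [? ?]; split; lra.
  by case=> ? ?; do 2 split; lra.
- move=> a b p; rewrite /edge_box /face /lo_side /hi_side /= minxx maxxx.
  rewrite min_succ max_succ.
  rewrite !rmorphD /=; split; last by case=> -[? ?] [? ?]; split; lra.
  by case=> ? ?; do 2 split; lra.
Qed.

Lemma face_interior_edge f x y p : plus_adjacent x y ->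
  f.1%:~R - 1 < p.1 - s < f.1%:~R -> f.2%:~R - 1 < p.2 - s < f.2%:~R ->
  ~ closed_segment pos [fset x; y]%fset p.
Proof.
have I (a b : int) : (a%:~R : R) < b%:~R -> a%:~R <= (b - 1)%:~R :> R.
  by rewrite ltr_int ler_int => h; lia.
move=> xy h1 h2; move: x y xy; apply: plus_adjacent_ind.
- by move=> x y H; rewrite fset2C.
- move=> a b /(segment_hE false) /= [_ h].
  have := @I b f.2; rewrite rmorphB /=; lra.
- move=> a b /(segment_vE false) /= [_ h].
  have := @I a f.1; rewrite rmorphB /=; lra.
Qed.

Lemma cycle_curveP c p : curve pos (cycle_edges c) p <->
  exists x y, on_cycle c x y /\ closed_segment pos [fset x; y]%fset p.
Proof.
split.
  case=> _ [x xc <-] h; exists x, (next c x); split => //; exact: on_cycle_next.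
by case=> x [y [/cycle_edgesP xy h]]; exists [fset x; y]%fset.
Qed.

Lemma open_segment_curve c x y p : plus_cycle c -> plus_adjacent x y ->
  ~~ on_cycle c x y -> open_segment pos [fset x; y]%fset p ->
  ~ curve pos (cycle_edges c) p.
Proof.
move=> Hc xy nc op /cycle_curveP[x' [y' [oc cp]]].
have := open_segment_edge xy (on_cycle_adjacent Hc oc) op cp.
by move=> E; move/negP: nc; apply; apply/cycle_edgesP; rewrite E; apply/cycle_edgesP.
Qed.

(** The segment from p to the centre runs, except for p, in the open face, which no edge
    enters. *)
Lemma face_centre_component c f p : plus_cycle c -> face f p ->
  ~ curve pos (cycle_edges c) p ->
  connected_component (~` curve pos (cycle_edges c)) p (face_centre f).
Proof.
move=> Hc fp np; pose g (t : R) := (1 - t) *: p + t *: face_centre f.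
have g0 : g 0 = p by rewrite /g subr0 scale1r scale0r addr0.
have g1 : g 1 = face_centre f by rewrite /g subrr scale1r scale0r add0r.
have cg : continuous g.
  move=> t; apply: cvgD; apply: cvgZ; first apply: cvgB;
    by [exact: cvg_cst|exact: cvg_id].
apply: (@connected_component_max _ _ (g @` `[0, 1]%classic)).
- by exists 0; rewrite //= in_itv /= lexx ler01.
- move=> _ [t + <-]; rewrite /= in_itv /= => /andP[t0 t1].
  have [->|tn] := eqVneq t 0; first by rewrite g0.
  have {t0 tn} t0 : 0 < t by rewrite lt_neqAle eq_sym tn.
  case/cycle_curveP => x [y [/(on_cycle_adjacent Hc) xy]].
  case: fp => f1 f2.
  apply: (@face_interior_edge f) => //; rewrite /g /face_centre /= /GRing.scale /=; nra.
- apply: connected_continuous_connected; first exact: segment_connected.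
  exact: continuous_subspaceT.
- by exists 1; rewrite //= in_itv /= lexx ler01.
Qed.

(** The two centres are joined through a point of the open edge xy. *)
Lemma adjacent_component c x y : plus_cycle c -> plus_adjacent x y ->
  ~~ on_cycle c x y ->
  connected_component (~` curve pos (cycle_edges c))
    (face_centre (lo_side x y)) (face_centre (hi_side x y)).
Proof.
move=> Hc xy nc; have [p op] := open_segment_nonempty x y.
have np := open_segment_curve Hc xy nc op.
have [f1 f2] := (sides_segment p xy).1 (open_closed_segment op).
apply: (@connected_component_trans _ _ p).
  by apply: connected_component_sym; exact: face_centre_component.
exact: face_centre_component.
Qed.

Lemma face_closed f : closed (face f).
Proof.
have -> : face f = closed_ball_ Num.norm (face_centre f) 2^-1.
  apply/seteqP; split => p; rewrite /closed_ball_ /face /face_centre /= prod_normE /= ge_max.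
    by case=> ? ?; apply/andP; split; rewrite ler_norml; lra.
  by rewrite !ler_norml => /andP[? ?]; split; lra.
exact: closed_closed_ball_.
Qed.

Lemma face_bound f p : face f p ->
  `|f.1|%:~R <= `|p.1| + `|s| + 1 :> R /\ `|f.2|%:~R <= `|p.2| + `|s| + 1 :> R.
Proof.
have B (a : int) (q : R) : a%:~R - 1 <= q - s <= a%:~R -> `|a|%:~R <= `|q| + `|s| + 1 :> R.
  move=> h; rewrite intr_norm ler_norml.
  have := ler_norm q; have := ler_norm s; have := ler_norm (- q); have := ler_norm (- s).
  rewrite !normrN; lra.
by case=> h1 h2; split; apply: B.
Qed.

(** A union of infinitely many faces, closed because only finitely many of them come
    near a given point. *)
Lemma faces_closed (D : pred site) : closed [set p | exists f, D f /\ face f p].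
Proof.
move=> p clp.
have [M hM] : exists M : int, `|p| + `|s| + 2 <= M%:~R :> R.
  exists (Posz (Num.bound (`|p| + `|s| + 2))); apply/ltW.
  by rewrite -pmulrn; apply: archi_boundP; rewrite addr_ge0 // addr_ge0.
have cM : closed (\bigcup_(f in [set f | f \in box M /\ D f]) face f).
  apply: closed_bigcup => [|f _]; last exact: face_closed.
  apply: (sub_finite_set (B := [set` box M])); last exact: finite_seq.
  by move=> f [].
suff /cM[f [_ Df] pf] : closure (\bigcup_(f in [set f | f \in box M /\ D f]) face f) p.
  by exists f.
move=> B nB.
have /clp[q [[f [Df fq]] [Bq bq]]] : nbhs p (B `&` ball p 1).
  by apply: filterI => //; apply: nbhsx_ballx.
exists q; split=> //; exists f => //; split=> //.
have [h1 h2] := face_bound fq.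
have : `|p - q| < 1 by move: bq; rewrite -ball_normE.
rewrite prod_normE /= gt_max => /andP[d1 d2].
have : `|p.1| <= `|p| /\ `|p.2| <= `|p| by rewrite prod_normE !le_max !lexx orbT.
have T (a b : R) : `|a - b| < 1 -> `|b| <= `|a| + 1.
  by move=> h; have := ler_normB a (a - b); rewrite opprB addrC subrK; lra.
have := T _ _ d1; have := T _ _ d2 => ? ? [? ?].
by apply: mem_box; rewrite -(ler_int R); lra.
Qed.

End Plane.

(** * Interior and exterior of a drawn cycle *)

Lemma bounded_setP (R : realType) (K : set (R * R)) :
  bounded_set K <-> exists M : R, forall p, K p -> `|p| <= M.
Proof.
split=> [/ex_strict_bound_gt0[M _ hM]|[M hM]].
  by exists M => p Kp; apply/ltW/hM.
rewrite /= /bounded_near; near=> M' => p Kp /=; apply: (le_trans (hM p Kp)).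
by near: M'; apply: nbhs_pinfty_ge; rewrite num_real.
Unshelve. all: by end_near. Qed.

Section Jordan.
Variables (R : realType) (s : R).
Implicit Types (p q : R * R) (x y f g : site) (c : seq site).
Let pos := shifted_pos s.

Lemma in_face p : exists f, face s f p.
Proof.
exists (Num.floor (p.1 - s) + 1, Num.floor (p.2 - s) + 1).
rewrite /face /= !rmorphD /=.
have := floor_itv (p.1 - s); have := floor_itv (p.2 - s); rewrite !rmorphD /=.
by move=> ? ?; split; lra.
Qed.

(** Off the curve [inside c] is a function of points: moving from f to g within the
    faces at p crosses only edges containing p, and these are not on the cycle. *)
Lemma face_inside c f g p : plus_cycle c -> ~ curve pos (cycle_edges c) p ->
  face s f p -> face s g p -> inside c f = inside c g.
Proof.
move=> Hc np.
have adj f' g' : plus_adjacent f' g' -> face s f' p -> face s g' p ->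
    inside c f' = inside c g'.
  move=> /adjacent_sides[x [y [xy h]]] f1 f2.
  have : ~~ on_cycle c x y.
    apply/negP => oc; apply: np; apply/cycle_curveP; exists x, y; split => //.
    by apply/(sides_segment _ _ xy); case: h => -[-> ->].
  by rewrite -separates_inside // /separates; case: h => -[-> ->]; do 2 case: (inside c _).
have near (a b : int) (q : R) : a%:~R - 1 <= q - s <= a%:~R ->
    b%:~R - 1 <= q - s <= b%:~R -> `|a - b| <= 1.
  move=> h1 h2.
  have : a <= b + 1 by rewrite -(ler_int R) rmorphD /=; lra.
  have : b <= a + 1 by rewrite -(ler_int R) rmorphD /=; lra.
  lia.
move=> fp gp; have hp : face s (f.1, g.2) p by case: fp gp => ? _ [_ ?].
transitivity (inside c (f.1, g.2)).
  have [e|ne] := eqVneq f.2 g.2; first by congr (inside c _); apply: siteP.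
  apply: adj => //; case: fp gp => _ h1 [_ h2]; have := near _ _ _ h1 h2.
  by rewrite plus_adjacentE /=; lia.
have [e|ne] := eqVneq f.1 g.1; first by congr (inside c _); apply: siteP.
apply: adj => //; case: fp gp => h1 _ [h2 _]; have := near _ _ _ h1 h2.
by rewrite plus_adjacentE /=; lia.
Qed.

(** The points off the curve on inside faces and those on outside faces are separated
    sets, since unions of faces are closed. *)
Lemma component_faces c f p : plus_cycle c -> ~ curve pos (cycle_edges c) p ->
  face s f p -> forall q g,
  connected_component (~` curve pos (cycle_edges c)) p q -> face s g q ->
  inside c g = inside c f.
Proof.
move=> Hc np fp.
pose W b := [set q | ~ curve pos (cycle_edges c) q /\
                     exists g, inside c g = b /\ face s g q].
have Wdisj b q : closure (W b) q -> W (~~ b) q -> False.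
  move=> cl [nq [g [insg gq]]].
  suff [g' [insg' gq']] : [set q' | exists g', inside c g' = b /\ face s g' q'] q.
    by have := face_inside Hc nq gq gq'; rewrite insg insg'; case: (b).
  have := @faces_closed R s (fun g => inside c g == b) q.
  case=> [|g' [/eqP ? ?]]; last by exists g'.
  by apply: closureS cl => q' [_ [g' [<- ?]]]; exists g'.
have sepW b : separated (W b) (W (~~ b)).
  split; apply/seteqP; split=> q //= [].
    by move=> h1 h2; apply: (Wdisj b q).
  by move=> h1 h2; apply: (Wdisj (~~ b) q); rewrite ?negbK.
set K := connected_component _ p.
have KW : K `<=` W (inside c f) `|` W (~~ inside c f).
  move=> q /connected_component_sub nq; have [g gq] := in_face q.
  have [e|e] := eqVneq (inside c g) (inside c f); [left|right]; split => //; exists g.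
    by split.
  by split=> //; move: e; do 2 case: (inside c _).
have Kp : K p by exact: connected_component_refl.
case: (connected_subset (sepW _) KW (@component_connected _ _ _)) => h q g Kq gq.
  by have [nq [g' [<- gq']]] := h q Kq; apply: face_inside gq gq'.
have [_ [g' [e gp']]] := h p Kp.
by have := face_inside Hc np fp gp'; rewrite e; case: (inside c f).
Qed.

(** Inside, the component is covered by the finitely many inside faces.  Conversely, the
    faces whose centres lie in the component of p change only across c, so by [jordan]
    they contain all outside faces as soon as f is one, and are unbounded. *)
Lemma bounded_component c f p : plus_cycle c -> ~ curve pos (cycle_edges c) p ->
  face s f p ->
  bounded_set (connected_component (~` curve pos (cycle_edges c)) p) <-> inside c f.
Proof.
move=> Hc np fp; have [N HN] := inside_bounded Hc.
set K := connected_component _ p.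
rewrite bounded_setP; split; last first.
  move=> insf; exists (N%:~R + `|s| + 1) => q Kq.
  have [g gq] := in_face q.
  have [] := HN g; first by rewrite (component_faces Hc np fp Kq gq).
  rewrite -2!(ler_int R) !intr_norm prod_normE ge_max.
  case: gq; rewrite !ler_norml.
  have := ler_norm s; have := ler_norm (- s); rewrite normrN.
  by move=> *; apply/andP; split; lra.
case=> M HM; apply: contrapT => /negP ninsf.
have Kc g q : face s g q -> K q -> K (face_centre s g).
  move=> gq Kq; apply: (connected_component_trans Kq).
  by apply: face_centre_component => //; apply: connected_component_sub Kq.
have Kf : K (face_centre s f).
  by apply: (Kc _ p) => //; exact: connected_component_refl.
pose D g := `[< K (face_centre s g) >].
(* D contains all faces far to the right, in each case that jordan leaves *)
have [m Hm] : exists m : int, forall g, m < g.1 -> D g.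
  have [x y xy|E|[b E]] := jordan (D := D) Hc.
  - move=> nc; have h := adjacent_component s Hc xy nc.
    rewrite /separates; suff -> : D (lo_side x y) = D (hi_side x y) by rewrite addbb.
    apply: asbool_equiv_eq; split=> h'; apply: (connected_component_trans h') => //.
    exact: connected_component_sym.
  - by exists 0 => g _; rewrite (E g f); apply/asboolP.
  have b1 : b = true.
    have /asboolP := Kf; rewrite -/(D f) E (negbTE ninsf) addbF.
    by [].
  exists N => g gN; rewrite E b1 /=; apply/negP => /HN; lia.
have [k hk] : exists k : nat, `|M| + `|s| + 2 < k%:R :> R.
  exists (Num.bound (`|M| + `|s| + 2)); apply: archi_boundP.
  by rewrite !addr_ge0.
have /Hm/asboolP/HM : m < (`|m| + k%:Z + 1, 0 : int).1 by move=> /=; lia.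
rewrite /face_centre prod_normE ge_max /= => /andP[+ _].
rewrite !rmorphD /= -pmulrn intr_norm ler_norml.
have := ler_norm s; have := ler_norm (- s); have := ler_norm M.
have : 0 <= `|m%:~R| :> R by [].
rewrite normrN; lra.
Qed.

Lemma jordan_interior c f p : plus_cycle c -> ~ curve pos (cycle_edges c) p ->
  face s f p -> cycle_interior pos (cycle_edges c) p <-> inside c f.
Proof.
move=> Hc np fp; rewrite /cycle_interior /=.
by rewrite -(bounded_component Hc np fp); split=> [[]|].
Qed.

Lemma jordan_exterior c f p : plus_cycle c -> ~ curve pos (cycle_edges c) p ->
  face s f p -> cycle_exterior pos (cycle_edges c) p <-> ~~ inside c f.
Proof.
move=> Hc np fp; rewrite /cycle_exterior /=.
split=> [[_ nb]|/negP nb]; first by apply/negP => /(bounded_component Hc np fp).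
by split=> // /(bounded_component Hc np fp).
Qed.
End Jordan.

(** * Cycles with the same edges *)

Lemma same_next_rot (T : eqType) (L F : seq T) : uniq L -> uniq F ->
  L =i F -> {in L, next L =1 next F} -> exists k, F = rot k L.
Proof.
move=> UL UF LF nLF; case: F => [|x q] in UF LF nLF *.
  exists 0%N; case: L LF {UL nLF} => // a L /(_ a); by rewrite mem_head.
have xL : x \in L by rewrite LF mem_head.
have [i p E] := rot_to xL; exists i; rewrite E; congr cons.
have fE (f : T -> T) r : fcycle f (x :: r) -> r = traject f (f x) (size r).
  by rewrite /cycle rcons_path => /andP[/fpathE].
have UE : uniq (x :: p) by rewrite -E rot_uniq.
have Es : size p = size q.
  have : size (x :: p) = size (x :: q).
    by rewrite -E size_rot; apply/perm_size/uniq_perm.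
  by case.
have trE (f g : T -> T) y n : (forall k, f (iter k f y) = g (iter k f y)) ->
    traject f y n = traject g y n.
  elim: n y => //= n IH y h; rewrite -(h 0%N) IH // => k.
  by rewrite -!iterSr; exact: h.
have nE y : y \in L -> next (x :: p) y = next (x :: q) y.
  by move=> yL; rewrite -E next_rot // nLF.
rewrite [LHS](fE _ _ (cycle_next UF)) [RHS](fE _ _ (cycle_next UE)) -Es -(nE x xL).
apply/esym/trE => k; apply: nE; rewrite -(mem_rot i) E.
by apply: iter_next_mem; rewrite mem_next mem_head.
Qed.

Lemma on_cycle_rev c x y : uniq c -> on_cycle (rev c) x y = on_cycle c x y.
Proof.
move=> Uc; have E a b : (a \in rev c) && (b == next (rev c) a) =
    (b \in c) && (a == next c b).
  rewrite mem_rev next_rev //; apply/andP/andP => -[ac /eqP->].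
    by rewrite mem_prev next_prev.
  by rewrite mem_next prev_next.
by rewrite /on_cycle !E orbC.
Qed.

Lemma on_cycle_rot k c x y : uniq c -> on_cycle (rot k c) x y = on_cycle c x y.
Proof. by move=> Uc; rewrite /on_cycle !mem_rot !next_rot. Qed.

(** Once the two cycles leave one common vertex in the same direction they can never
    part: at each vertex the edge already used cannot be the next one. *)
Lemma on_cycle_rot_next (L F : seq site) x0 : uniq L -> (3 <= size L)%N ->
  uniq F -> (forall x y, on_cycle L x y = on_cycle F x y) ->
  x0 \in L -> next L x0 = next F x0 -> exists k, F = rot k L.
Proof.
move=> UL SL UF E x0L nx0.
have sub (c c' : seq site) : (forall x y, on_cycle c x y = on_cycle c' x y) ->
    {subset c <= c'}.
  move=> Ec x xc; have := on_cycle_next xc; rewrite Ec.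
  by case/on_cycle_mem/andP.
have LF : L =i F by move=> x; apply/idP/idP; apply: sub.
apply: same_next_rot => // x xL.
have [k ->] := next_reach UL x0L xL.
elim: k => //= k IH; set z := iter k _ _ in IH *.
have zL : z \in L by exact: iter_next_mem.
have := on_cycle_next (c := L) (x := next L z); rewrite mem_next E => /(_ zL).
case/orP => /andP[_ /eqP //].
rewrite {1}IH => /(can_inj (prev_next UF)) e.
by have := next2_neq UL SL zL; rewrite -e eqxx.
Qed.

(** At a common vertex the two cycles use the same two edges, so up to reversal they
    leave it along the same one. *)
Lemma same_skeleton L F : plus_cycle L -> plus_cycle F ->
  (forall x y, on_cycle L x y = on_cycle F x y) -> same_cycle L F.
Proof.
move=> HL [UF SF _] E; have [UL SL _] := HL.
have [x0 x0L] := plus_cycle_mem HL.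
have := on_cycle_next x0L; rewrite E => /orP[] /andP[h /eqP e].
  by have [k ->] := on_cycle_rot_next UL SL UF E x0L e; exists k; left.
have [|||k e'] := on_cycle_rot_next UL SL (F := rev F) _ _ x0L.
- by rewrite rev_uniq.
- by move=> x y; rewrite on_cycle_rev.
- by rewrite next_rev // {2}e prev_next.
exists (size L - k)%N; right; rewrite -[F]revK e' rev_rot.
by rewrite /rotr size_rev.
Qed.

Lemma same_cycle_on_cycle L F : plus_cycle L -> same_cycle L F ->
  forall x y, on_cycle L x y = on_cycle F x y.
Proof.
move=> [UL _ _] [k [->|->]] x y; first by rewrite on_cycle_rot.
by rewrite on_cycle_rot ?rev_uniq // on_cycle_rev.
Qed.

(** * Cycles of vacant squares surrounding the component *)

Lemma corner_const (D : pred site) z f g :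
  (forall w, plus_adjacent z w -> ~~ separates D z w) ->
  z \in square_corners f -> z \in square_corners g -> D f = D g.
Proof.
move=> h.
have eq_of b b' : b (+) b' = false -> b' = b by case: b b' => [] [].
have h' w : plus_adjacent z w -> separates D z w = false by move/h/negbTE.
have [hl hr hd _] := separates_around D z.
have E f' : z \in square_corners f' -> D f' = D z.
  have h1 : D (z.1 + 1, z.2) = D z.
    by apply: eq_of; rewrite -hd h' // plus_adjacentE /=; lia.
  have h2 : D (z.1, z.2 + 1) = D z.
    by apply: eq_of; rewrite -hl h' // plus_adjacentE /=; lia.
  have h3 : D (z.1 + 1, z.2 + 1) = D (z.1 + 1, z.2).
    by apply: eq_of; rewrite -hr h' // plus_adjacentE /=; lia.
  rewrite square_cornersE => zf.
  have : f' = z \/ f' = (z.1 + 1, z.2) \/ f' = (z.1, z.2 + 1) \/ f' = (z.1 + 1, z.2 + 1).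
    case/andP: zf => /orP[]/eqP e1 /orP[]/eqP e2.
    - by left; apply: siteP.
    - by right; right; left; apply: siteP => /=; lia.
    - by right; left; apply: siteP => /=; lia.
    - by right; right; right; apply: siteP => /=; lia.
  by case=> [->|[->|[->|->]]] //; rewrite h3.
by move=> /E -> /E ->.
Qed.

Lemma corner_sides x y : plus_adjacent x y ->
  (x \in square_corners (lo_side x y)) && (x \in square_corners (hi_side x y)).
Proof. by rewrite plus_adjacentE !square_cornersE /=; lia. Qed.

Lemma star_adjacent_corner z w : star_adjacent z w ->
  exists f, z \in square_corners f /\ w \in square_corners f.
Proof.
rewrite star_adjacentE => /and3P[_ h1 h2].
exists (Num.max z.1 w.1, Num.max z.2 w.2); rewrite !square_cornersE /=; lia.
Qed.

Section Component.
Variable occ : pred site.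
Hypothesis occ0 : occ origin.

Lemma component0_occ z : component0 occ z -> occ z.
Proof. by case=> p [_ _ <-] /allP; apply; rewrite mem_last. Qed.

(** The extended path may revisit squares and has to be shortened to a simple one. *)
Lemma component0_step z w : component0 occ z -> star_adjacent z w -> occ w ->
  component0 occ w.
Proof.
case=> p [pp up lp] op zw ow.
have : path star_adjacent origin (rcons p w) by rewrite rcons_path pp lp.
have : w = last origin (rcons p w) by rewrite last_rcons.
move=> E pw; rewrite [X in component0 _ X]E; case/shortenP: pw => p' pp' up' sp'.
exists p' => //; rewrite /= occ0 /=; apply/allP => a /sp'.
by rewrite mem_rcons inE => /orP[/eqP->|ap] //; apply: (allP op); rewrite inE ap orbT.
Qed.

Lemma component0_ind (Q : site -> Prop) : Q origin ->
  (forall z w, component0 occ z -> component0 occ w -> star_adjacent z w ->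
     Q z -> Q w) ->
  forall z, component0 occ z -> Q z.
Proof.
move=> Q0 QS z [p [pp _ <-] op].
elim/last_ind: p pp op => // p w IH; rewrite rcons_path last_rcons -rcons_cons all_rcons.
move=> /andP[pp zw] /andP[ow op].
have Cz : component0 occ (last origin p).
  case/shortenP: pp => p' pp' up' sp'; exists p' => //.
  rewrite /= occ0; apply/allP => a /sp' ap; apply: (allP op); rewrite inE ap orbT //.
apply: (QS (last origin p)) => //; last exact: IH.
exact: component0_step Cz zw ow.
Qed.

Lemma component0_origin : component0 occ origin.
Proof. by exists [::] => //=; rewrite occ0. Qed.

(** The faces of the dual graph with a corner in C(0): each occupied square contributes
    the 2 by 2 block of dual faces around its centre.  Blocks of star adjacent squares
    overlap, which turns star connectedness of C(0) into plus connectedness of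
    faces. *)
Definition blocks : pred site := fun f =>
  has (fun v => `[< component0 occ v >]) (square_corners f).

Lemma blocksP f : blocks f <-> exists2 v, component0 occ v & v \in square_corners f.
Proof.
split; first by case/hasP => v vf /asboolP; exists v.
by case=> v Cv vf; apply/hasP; exists v => //; apply/asboolP.
Qed.

Lemma blocks_connected : connected_region blocks.
Proof.
move=> D lD.
have around z f g : component0 occ z -> z \in square_corners f ->
    z \in square_corners g -> D f = D g.
  move=> Cz; apply: corner_const => w zw; have /andP[h1 h2] := corner_sides zw.
  by rewrite (separates_locally_constant lD) //; apply/blocksP; exists z.
have C0 := component0_origin.
suff E f : blocks f -> D f = D origin by move=> f g /E -> /E ->.
move=> /blocksP[z Cz zf]; move: z Cz f zf; apply: component0_ind.
  by move=> f zf; apply: (around origin) => //; rewrite square_cornersE /= eqxx.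
move=> z w Cz Cw zw IH f wf; have [g [zg wg]] := star_adjacent_corner zw.
by rewrite (around w f g) // IH.
Qed.

(** Any two corners of a face are star adjacent. *)
Lemma corner_Lambda0 x f : x \in square_corners f -> blocks f ->
  ~ component0 occ x -> Lambda0 occ x.
Proof.
move=> xf /blocksP[v Cv vf] nx.
have xv : star_adjacent x v.
  have nxv : x != v by apply/eqP => e; apply: nx; rewrite e.
  rewrite star_adjacentE nxv; move: xf vf; rewrite !square_cornersE; lia.
split; last by exists v.
apply/negP => ox; apply: nx; apply: component0_step ox; first exact: Cv.
by move: xv; rewrite !star_adjacentE eq_sym (distrC x.1) (distrC x.2).
Qed.

(** The combinatorial content of [properties_i_iii] for a plus connected cycle; the
    equivalence is [surroundingP]. *)
Definition surrounding (F : seq site) :=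
  [/\ plus_cycle F, (forall v : site, v \in F -> Lambda0 occ v)
    & (forall f, blocks f -> inside F f)].

Hypothesis fin : finite_set (component0 occ).

Lemma component0_bounded : exists N : int, forall z, component0 occ z ->
  `|z.1| <= N /\ `|z.2| <= N.
Proof.
have /finite_seqP[r E] := fin; have [N HN] := bounded_region_seq r.
by exists N => z; rewrite E => /HN.
Qed.

(** The hull of the blocks alone would not do: where C(0) leaves a gap of two vacant
    squares, the edge joining them closes off a pocket that belongs to the inside of a
    surrounding cycle but not to that hull.  Adding the insides of all surrounding
    cycles before taking the hull makes the result largest by construction. *)
Lemma outermost_surrounding : exists L, surrounding L /\
  forall F, surrounding F -> forall f, inside F f -> inside L f.
Proof.
pose B f := `[< blocks f \/ exists F, surrounding F /\ inside F f >].
have BA f : blocks f -> B f by move=> ?; apply/asboolP; left.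
have BF F f : surrounding F -> inside F f -> B f.
  by move=> ? ?; apply/asboolP; right; exists F.
have C0 := component0_origin.
have A0 : blocks origin.
  by apply/blocksP; exists origin => //; rewrite square_cornersE /= eqxx.
(* the vertices of a surrounding cycle are adjacent to C(0), so all surrounding
   cycles lie in one box *)
have fB : bounded_region B.
  have [N HN] := component0_bounded; exists (N + 2) => f /asboolP[].
    case/blocksP => v /HN; rewrite square_cornersE; lia.
  case=> F [[HF LF _]]; have h := @inside_bound F (N + 1) f HF.
  move=> insf.
  suff : `|f.1| <= N + 1 + 1 /\ `|f.2| <= N + 1 + 1 by lia.
  apply: (h _ insf) => x /LF[_ [w /HN]]; rewrite star_adjacentE; lia.
have cB : connected_region B.
  move=> D lD; suff E f : B f -> D f = D origin by move=> f g /E -> /E ->.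
  have lA : locally_constant blocks D.
    by move=> f' g fg /BA Af /BA Ag; apply: lD.
  have EA f' : blocks f' -> D f' = D origin by move=> ?; apply: blocks_connected.
  case/asboolP => [/EA //|[F [SF insf]]]; have [HF _ AF] := SF.
  have lF : locally_constant (inside F) D.
    by move=> f' g fg /(BF _ _ SF) Bf /(BF _ _ SF) Bg; apply: lD.
  by apply: (inside_connected HF lF) => //; apply: AF.
have [L [HL EL]] := hull_cycle fB (BA _ A0) cB.
exists L; split; last first.
  by move=> F SF f insf; rewrite EL; apply: sub_hull => //; apply: BF insf.
split=> //; last by move=> f /BA Bf; rewrite EL; exact: sub_hull.
move=> x xL; set y := next L x; have xy : plus_adjacent x y by exact: plus_cycle_next.
have /andP[x1 x2] := corner_sides xy.
have : separates (inside L) x y by rewrite separates_inside // on_cycle_next.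
rewrite /separates !EL.
(* f and g are the two faces bordering the edge xy, in either order *)
have key f g : plus_adjacent f g -> x \in square_corners f -> x \in square_corners g ->
  (forall F, inside F f -> ~~ inside F g -> separates (inside F) x y) ->
  hull B f -> ~~ hull B g -> Lambda0 occ x.
  move=> fg xf xg hF Hf Hg.
  have Bg : ~~ B g by apply: contra Hg; exact: sub_hull.
  have /asboolP[Af|[F [SF insf]]] := hull_boundary fB fg Hf Hg.
    apply: (corner_Lambda0 xf Af) => Cx; move/negP: Bg; apply; apply: BA.
    by apply/blocksP; exists x.
  have [HF LF _] := SF.
  have : separates (inside F) x y.
    by apply: hF => //; apply: contra Bg; apply: BF.
  by rewrite separates_inside // => /on_cycle_mem/andP[/LF].
have [H1|H1] := boolP (hull B (lo_side x y));
  have [H2|H2] := boolP (hull B (hi_side x y)) => // _.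
  apply: (key _ _ (sides_adjacent xy)) => // F i1 /negbTE i2.
  by rewrite /separates i1 i2.
apply: (key (hi_side x y) (lo_side x y)) => //.
  by rewrite plus_adjacent_sym sides_adjacent.
by move=> F i1 /negbTE i2; rewrite /separates i1 i2.
Qed.

End Component.

(** * Plane properties of plus connected cycles *)

Section Squares.
Variable R : realType.
Implicit Types (p q : R * R) (x y z f g : site) (c L F : seq site).

Lemma dual_posE : @dual_pos R = shifted_pos 0.
Proof. by apply/funext => z; rewrite /dual_pos /shifted_pos !addr0. Qed.

Lemma square_interior z p : (@square R z)° p <->
  `|p.1 - z.1%:~R| < 2^-1 /\ `|p.2 - z.2%:~R| < 2^-1.
Proof.
rewrite /interior /=; split.
  move=> /nbhs_ballP[e /= e0 be].
  have B (q : R * R) : `|p.1 - q.1| < e -> `|p.2 - q.2| < e -> @square R z q.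
    move=> h1 h2; apply: be; rewrite -ball_normE /= prod_normE gt_max /=.
    by rewrite h1 h2.
  have d0 : `|0 : R| < e by rewrite normr0.
  have d1 : `|e / 2| < e by rewrite ger0_norm; lra.
  have [/= a1 a2] : @square R z (p.1 - e / 2, p.2 - e / 2).
    by apply: B => /=; rewrite opprB addrC subrK.
  have [/= b1 b2] : @square R z (p.1 + e / 2, p.2 + e / 2).
    by apply: B => /=; rewrite opprD addrA subrr sub0r normrN.
  move: a1 a2 b1 b2; rewrite !ler_norml !ltr_norml => *; split; lra.
rewrite !ltr_norml => -[h1 h2].
apply/nbhs_ballP.
(* the distance from p to the boundary of the square *)
exists (Num.min (Num.min (p.1 - z.1%:~R + 2^-1) (2^-1 - (p.1 - z.1%:~R)))
  (Num.min (p.2 - z.2%:~R + 2^-1) (2^-1 - (p.2 - z.2%:~R)))) => /=.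
  by rewrite !lt_min; lra.
move=> q; rewrite -ball_normE /= prod_normE gt_max /= !lt_min !ltr_norml.
by move=> h; rewrite /square /= !ler_norml; split; lra.
Qed.

Lemma face_square z p : face 2^-1 z p <-> @square R z p.
Proof. by rewrite /face /square /= !ler_norml; split=> -[? ?]; split; lra. Qed.

(** A skeleton edge stays in the two squares whose centres it joins. *)
Lemma dual_segment_square x y f p : plus_adjacent x y ->
  closed_segment (shifted_pos 0) [fset x; y]%fset p -> @square R f p ->
  f = x \/ f = y.
Proof.
move=> xy; move: x y xy; apply: plus_adjacent_ind.
- by move=> x y H; rewrite fset2C => h1 h2; have [] := H h1 h2; auto.
- move=> a b; rewrite closed_segmentE ?plus_adjacentE /=; last by lia.
  rewrite /edge_box /square /= minxx maxxx.
  rewrite min_succ max_succ.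
  rewrite rmorphD /= !ler_norml => -[h1 h2] [h3 h4].
  have e2 : f.2 = b by apply/le_anti/andP; split; apply: (@intr_ltD1 R); lra.
  have l1 : a <= f.1 by apply: (@intr_ltD1 R); lra.
  have l2 : f.1 <= a + 1 by apply: (@intr_ltD1 R); rewrite rmorphD /=; lra.
  have [e|e] : f.1 = a \/ f.1 = a + 1 by lia.
    by left; apply: siteP.
  by right; apply: siteP.
- move=> a b; rewrite closed_segmentE ?plus_adjacentE /=; last by lia.
  rewrite /edge_box /square /= minxx maxxx.
  rewrite min_succ max_succ.
  rewrite rmorphD /= !ler_norml => -[h1 h2] [h3 h4].
  have e2 : f.1 = a by apply/le_anti/andP; split; apply: (@intr_ltD1 R); lra.
  have l1 : b <= f.2 by apply: (@intr_ltD1 R); lra.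
  have l2 : f.2 <= b + 1 by apply: (@intr_ltD1 R); rewrite rmorphD /=; lra.
  have [e|e] : f.2 = b \/ f.2 = b + 1 by lia.
    by left; apply: siteP.
  by right; apply: siteP.
Qed.

Lemma square_face_corner z f p : @square R z p -> face 0 f p ->
  z \in square_corners f.
Proof.
rewrite /square /face /= !ler_norml square_cornersE => -[h1 h2] [h3 h4].
have : f.1 - 1 <= z.1 by apply: (@intr_ltD1 R); rewrite rmorphB /=; lra.
have : z.1 <= f.1 by apply: (@intr_ltD1 R); lra.
have : f.2 - 1 <= z.2 by apply: (@intr_ltD1 R); rewrite rmorphB /=; lra.
have : z.2 <= f.2 by apply: (@intr_ltD1 R); lra.
lia.
Qed.

(** The skeleton can meet the square around z only along edges ending at z. *)
Lemma square_inside_dual L z : plus_cycle L -> z \notin L ->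
  (forall f, z \in square_corners f -> inside L f) ->
  square_inside (@dual_pos R) (skeleton L) z.
Proof.
move=> HL zL hz p /interior_subset sp; rewrite dual_posE.
have np : ~ curve (shifted_pos 0) (cycle_edges L) p.
  case/cycle_curveP => x [y [oc cp]].
  have [/= xL yL] := andP (on_cycle_mem oc).
  have := dual_segment_square (on_cycle_adjacent HL oc) cp sp.
  by case=> e; move: zL; rewrite e ?xL ?yL.
have [f pf] := in_face 0 p.
by apply/(jordan_interior HL np pf); apply: hz; apply: square_face_corner pf.
Qed.

(** The point halfway between z and the centre of the face f is interior to the
    square z and lies in f. *)
Lemma square_inside_face L z f : plus_cycle L ->
  square_inside (@dual_pos R) (skeleton L) z -> z \in square_corners f -> inside L f.
Proof.
move=> HL; rewrite dual_posE square_cornersE => hz zf.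
pose p : R * R := (z.1%:~R + (f.1%:~R - z.1%:~R - 2^-1) / 2,
                   z.2%:~R + (f.2%:~R - z.2%:~R - 2^-1) / 2).
have [e1 e2] : (f.1%:~R = z.1%:~R :> R \/ f.1%:~R = z.1%:~R + 1 :> R) /\
  (f.2%:~R = z.2%:~R :> R \/ f.2%:~R = z.2%:~R + 1 :> R).
  by case/andP: zf => /orP[]/eqP -> /orP[]/eqP ->; split; rewrite ?rmorphB /=;
    ((by left) || (right; lra)).
have /hz hp : (@square R z)° p.
  by apply/square_interior; rewrite /p /= !ltr_norml;
    case: e1 e2 => -> [] ->; split; lra.
apply: (jordan_interior HL hp.1 _).1 hp.
by rewrite /face /p /=; case: e1 e2 => -> [] ->; split; lra.
Qed.

Lemma open_edge_inside L x y : plus_cycle L -> plus_adjacent x y ->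
  ~~ on_cycle L x y -> inside L (lo_side x y) ->
  open_segment (@dual_pos R) [fset x; y]%fset
    `<=` cycle_interior (@dual_pos R) (skeleton L).
Proof.
move=> HL xy nc inl p; rewrite dual_posE => op.
have np := open_segment_curve HL xy nc op.
have [f1 _] := (sides_segment _ _ xy).1 (open_closed_segment op).
by apply/(jordan_interior HL np f1).
Qed.

(** A point of the open edge lies in both bordering faces. *)
Lemma open_edge_inside_sides L x y : plus_cycle L -> plus_adjacent x y ->
  open_segment (@dual_pos R) [fset x; y]%fset
    `<=` cycle_interior (@dual_pos R) (skeleton L) ->
  inside L (lo_side x y) && inside L (hi_side x y).
Proof.
rewrite dual_posE => HL xy h; have [p op] := open_segment_nonempty (0 : R) x y.
have hp := h p op; have [f1 f2] := (sides_segment _ _ xy).1 (open_closed_segment op).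
have i1 := (jordan_interior HL hp.1 f1).1 hp.
by rewrite i1; exact: ((jordan_interior HL hp.1 f2).1 hp).
Qed.

Lemma plus_cycle_size c : plus_cycle c -> (4 <= size c)%N.
Proof.
case: c => [|x [|y [|z [|w c]]]] // [] // _ _.
by rewrite /= !plus_adjacentE => /and4P[]; lia.
Qed.

Lemma is_cycle_plus_cycle C c : is_cycle (graph_edges C) c -> plus_cycle c.
Proof.
case=> Uc Sc Ec; split=> //; first exact: leq_trans Sc.
apply: cycle_from_next => // x xc.
have /Ec/graph_edgesP[a [b [/fset2_eq E ab _]]] : cycle_edges c [fset x; next c x]%fset.
  by exists x.
by case: E => -[-> ->] //; rewrite plus_adjacent_sym.
Qed.

Lemma plus_cycle_region_connected L : plus_cycle L -> connected_region (mem L).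
Proof.
move=> HL D lD; have [UL _ _] := HL; apply: next_const => // x xL.
by apply: lD => //; rewrite /= ?mem_next //; apply: plus_cycle_next.
Qed.

Lemma cycle_edgesE c e : cycle_edges c e ->
  exists x y, e = [fset x; y]%fset /\ on_cycle c x y.
Proof. by case=> x xc <-; exists x, (next c x); split => //; exact: on_cycle_next. Qed.

(** The outermost boundary is the boundary d of the hull of the squares of L.  An edge of
    d separates a square of L from a square g outside the hull.  A cycle c made of edges of
    squares of L has its inside in the hull, so g is outside c, and the edge is on c or
    exterior to c.  Conversely, any other edge of a square of L borders a square that is
    inside d, so that d itself disqualifies it. *)
Lemma plus_cycle_property_ii L : plus_cycle L -> property_ii R L.
Proof.
move=> HL; have fL := bounded_region_seq L.
have [v0 v0L] := plus_cycle_mem HL.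
have [d [Hd Ed]] := hull_cycle fL v0L (plus_cycle_region_connected HL).
have Ld v : v \in L -> inside d v by move=> vL; rewrite Ed; apply: sub_hull.
have dside x y : on_cycle d x y ->
    plus_adjacent x y /\ exists f g, [/\ f \in L, ~~ inside d g &
      (lo_side x y = f /\ hi_side x y = g) \/ (lo_side x y = g /\ hi_side x y = f)].
  move=> oc; have xy := on_cycle_adjacent Hd oc; split=> //.
  have := separates_inside Hd xy; rewrite oc /separates.
  have key f g : plus_adjacent f g -> inside d f -> ~~ inside d g -> f \in L.
    by rewrite !Ed => fg Hf Hg; apply: (hull_boundary fL fg Hf Hg).
  case i1 : (inside d (lo_side x y)); case i2 : (inside d (hi_side x y)) => //= _.
    exists (lo_side x y), (hi_side x y); rewrite i2; split; auto.
    by apply: (key _ _ (sides_adjacent xy)); rewrite ?i1 ?i2.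
  exists (hi_side x y), (lo_side x y); rewrite i1; split; auto.
  by apply: (key _ (lo_side x y)); rewrite ?i1 ?i2 // plus_adjacent_sym sides_adjacent.
have dL : cycle_edges d `<=` graph_edges [set` L].
  move=> e /cycle_edgesE[x [y [-> /dside[xy [f [g [fL' _ h]]]]]]].
  apply/graph_edgesP; exists x, y; split => //=.
  by case: h => -[e1 e2]; [left; rewrite e1|right; rewrite e2].
have [Ud _ _] := Hd; have Sd := plus_cycle_size Hd.
have is_d C : cycle_edges d `<=` graph_edges C -> is_cycle (graph_edges C) d by [].
exists d; split => //.
- apply: is_d => e /dL /graph_edgesP[x [y [-> xy _]]].
  by apply/graph_edgesP; exists x, y; split => //; left.
- apply/seteqP; split=> e.
    case=> /graph_edgesP[x [y [-> xy h]]] /(_ _ (is_d _ dL))[//|hext].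
    have [p op] := open_segment_nonempty (2^-1 : R) x y.
    have hp := hext p op.
    have [f1 f2] := (sides_segment _ _ xy).1 (open_closed_segment op).
    have n1 := (jordan_exterior Hd hp.1 f1).1 hp.
    have n2 := (jordan_exterior Hd hp.1 f2).1 hp.
    by case: h => /= /Ld; rewrite ?(negbTE n1) ?(negbTE n2).
  move=> de; split; first exact: dL.
  move=> c ic; have Hc := is_cycle_plus_cycle ic.
  have [x [y [eE oc]]] := cycle_edgesE de; rewrite {}eE in de *.
  have [xy [f [g [fL' dg h]]]] := dside _ _ oc.
  have [|nc] := boolP (on_cycle c x y); first by move/cycle_edgesP; left.
  right=> p op; have np := open_segment_curve Hc xy nc op.
  have [f1 f2] := (sides_segment _ _ xy).1 (open_closed_segment op).
  apply/(jordan_exterior Hc np f1).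
  (* c is made of edges of squares of L, so its inside is locally constant off L *)
  have cd g' : inside c g' -> inside d g'.
    rewrite Ed; apply: hull_max; first exact: inside_bounded.
    apply: locally_constant_separates => a b ab A1 A2; rewrite separates_inside //.
    apply/negP => /cycle_edgesP oab; have [_ _ Ec] := ic.
    have /graph_edgesP[a' [b' [/fset2_eq E _ H]]] := Ec _ oab.
    move/negP: A1; move/negP: A2; case: E H => -[-> ->] /= H;
      by case: H; rewrite 1?lo_sideC 1?hi_sideC.
  have ng : ~~ inside c g by apply: contra dg; apply: cd.
  have := separates_inside Hc xy; rewrite (negbTE nc) /separates.
  by case: h => -[-> ->]; rewrite ?(negbTE ng) ?addbF // => ->.
- move=> v vL p /square_interior[h1 h2].
  have fp : face 2^-1 v p by apply/face_square; split; apply: ltW.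
  apply/(jordan_interior Hd _ fp); last exact: Ld.
  case/cycle_curveP => x [y [/(on_cycle_adjacent Hd) xy]].
  apply: (@face_interior_edge _ _ v) => //; move: h1 h2; rewrite !ltr_norml; lra.
move=> e /cycle_edgesE[x [y [-> oc]]] p; rewrite dual_posE => cp.
have xy := on_cycle_adjacent HL oc; have /andP[xL yL] := on_cycle_mem oc.
have inL f : face 2^-1 f p -> f \in L.
  by move=> /face_square fp; case: (dual_segment_square xy cp fp) => ->.
have [f fp] := in_face (2^-1) p.
apply/(jordan_interior Hd _ fp); last by apply/Ld/inL.
case/cycle_curveP => a [b [oab cp']].
have [ab [f' [g' [_ ng h]]]] := dside _ _ oab.
have [/inL/Ld h1 /inL/Ld h2] := (sides_segment _ _ ab).1 cp'.
by case: h ng => -[e1 e2]; [rewrite -e2 h2|rewrite -e1 h1].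
Qed.

Lemma inside_on_cycle L F : plus_cycle L -> plus_cycle F -> inside L =1 inside F ->
  forall x y, on_cycle L x y = on_cycle F x y.
Proof.
move=> HL HF E x y.
have sepE : separates (inside L) x y = separates (inside F) x y by rewrite /separates !E.
by apply/idP/idP => oc; have := oc;
  [rewrite -(separates_inside HL) ?sepE ?separates_inside //; exact: on_cycle_adjacent oc
  |rewrite -(separates_inside HF) -?sepE ?separates_inside //; exact: on_cycle_adjacent oc].
Qed.

(** The faces inside F but outside L change only across L: an edge of F elsewhere would
    border two faces outside L.  By [jordan] this bounded set of faces, which misses the
    inside of L, is empty. *)
Lemma edges_inside_sub L F : plus_cycle L -> plus_cycle F ->
  (forall e, skeleton F e -> skeleton L e \/
     open_segment (@dual_pos R) e
       `<=` cycle_interior (@dual_pos R) (skeleton L)) ->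
  forall f, inside F f -> inside L f.
Proof.
move=> HL HF h f insf; apply: contraT => ninsf.
pose D g := inside F g && ~~ inside L g.
have Df : D f by rewrite /D insf.
have Dfin : bounded_region D.
  by apply: bounded_region_sub (inside_bounded HF) => g /andP[].
have [x y xy nc|E|[b E]] := jordan (D := D) HL.
- have E : inside L (lo_side x y) = inside L (hi_side x y).
    have := separates_inside HL xy; rewrite (negbTE nc) /separates.
    by do 2 case: (inside L _).
  rewrite /separates /D -E; have [|nl] := boolP (inside L (lo_side x y)).
    by rewrite !andbF.
  rewrite !andbT -[_ (+) _]/(separates (inside F) x y) separates_inside //.
  apply: contra nl => ocF.
  case: (h [fset x; y]%fset); first by apply/cycle_edgesP.
    by move/cycle_edgesP; rewrite (negbTE nc).
  by move/(open_edge_inside_sides HL xy)/andP => [].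
- have [g] := bounded_region_out Dfin; by rewrite (E g f) Df.
have [N HN] := inside_bounded HL; have [M HM] := Dfin.
have := E f; rewrite Df (negbTE ninsf) addbF => b1.
have D0 : D (`|N| + `|M| + 1, 0).
  by rewrite E -b1 /=; apply/negP => /HN /=; lia.
by have := HM _ D0 => /=; lia.
Qed.

Section Uniqueness.
Variable occ : pred site.
Hypothesis occ0 : occ origin.

Lemma property_iii_blocks L : plus_cycle L -> property_iii R occ L ->
  forall f, blocks occ f -> inside L f.
Proof.
move=> HL [h _] f /blocksP[z Cz zf].
exact: square_inside_face HL (h z Cz) zf.
Qed.

Lemma surrounding_property_iii L : surrounding occ L -> property_iii R occ L.
Proof.
case=> HL LL hL; split.
  move=> z Cz; apply: square_inside_dual => //.
    by apply/negP => /LL[+ _]; rewrite component0_occ.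
  by move=> f zf; apply: hL; apply/blocksP; exists z.
move=> y [_ [w Cw yw]] yL; apply: square_inside_dual => // f yf.
have [g [yg wg]] := star_adjacent_corner yw.
rewrite (corner_const (D := inside L) (z := y) (g := g)) //.
  by apply: hL; apply/blocksP; exists w.
move=> v yv; rewrite separates_inside //; apply: contra yL.
by case/on_cycle_mem/andP.
Qed.

Lemma surroundingP L : plus_cycle L ->
  properties_i_iii R occ L <-> surrounding occ L.
Proof.
move=> HL; split.
  case=> hi _ hiii; split=> //; first by move=> v /hi[].
  exact: property_iii_blocks.
move=> SL; split; [|exact: plus_cycle_property_ii|exact: surrounding_property_iii].
by case: SL => _ h _ v /h hv; split=> //; case: hv.
Qed.

Lemma largest_property_iv L : plus_cycle L ->
  (forall F, surrounding occ F -> forall f, inside F f -> inside L f) ->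
  property_iv R occ L.
Proof.
move=> HL hL F HF /(surroundingP HF) SF nLF; split.
  move=> E; apply: nLF; apply: same_skeleton => // x y.
  have {}E : cycle_edges F = cycle_edges L := E.
  by apply/idP/idP => /cycle_edgesP h; apply/cycle_edgesP; move: h; rewrite E.
move=> e /cycle_edgesE[x [y [-> oc]]].
have xy := on_cycle_adjacent HF oc.
have [/cycle_edgesP|nc] := boolP (on_cycle L x y); [by left|right].
apply: open_edge_inside => //.
have := separates_inside HF xy; have := separates_inside HL xy.
rewrite oc (negbTE nc) /separates.
have := hL F SF (lo_side x y); have := hL F SF (hi_side x y).
by case: (inside F _); case: (inside F _); case: (inside L _); case: (inside L _) => //= h1 h2;
  first [have := h1 isT | have := h2 isT].
Qed.

End Uniqueness.
End Squares.

Theorem theorem1 (R : realType) (occ : pred site)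
    (h_origin : occ origin)
    (h_finite : finite_set (component0 occ)) :
  exists Gout : seq site,
    [/\ plus_cycle Gout,
        properties_i_iii R occ Gout,
        property_iv R occ Gout
      & forall L : seq site, plus_cycle L -> properties_i_iii R occ L ->
          property_iv R occ L -> same_cycle Gout L].
Proof.
have [G [SG maxG]] := outermost_surrounding h_origin h_finite.
have [HG _ _] := SG; have PG := (@surroundingP R occ G HG).2 SG.
exists G; split=> //; first exact: largest_property_iv.
move=> L HL PL IVL; have SL := (@surroundingP R occ L HL).1 PL.
apply: contrapT => nGL.
have nLG : ~ same_cycle L G.
  move=> LG; apply: nGL; apply: same_skeleton => // x y.
  by rewrite (same_cycle_on_cycle HL LG).
have [_ /(edges_inside_sub HL HG) GL] := IVL G HG PG nLG.
have E : inside G =1 inside L by move=> f; apply/idP/idP; [exact: GL|exact: maxG].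
exact/nGL/same_skeleton/inside_on_cycle.
Qed.
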